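(* Let $k$ be an algebraically closed field of characteristic $0$, let $p \le q$ be odd primes, and let $H$ be a non-semisimple Hopf algebra over $k$ of dimension $pq$ with antipode $S$. Then there is an integer $d$ such that $$\mathrm{Tr}(S^{2p}) = p^2 d \quad\text{and}\quad d \equiv pq \pmod 4,$$ where $\mathrm{Tr}(S^{2p})$ is the trace of the $k$-linear endomorphism $S^{2p}$ of $H$.
   Context: A Hopf algebra is called semisimple if it is semisimple as an algebra. $S^{m}$ denotes the $m$-fold composite of the antipode $S: H \to H$. Since $k$ has characteristic $0$, integers are identified with their images in $k$. *)

(* Defs.v *)
From HB Require Import structures.
From mathcomp Require Export all_boot all_order all_algebra all_field.

Set Implicit Arguments.
Unset Strict Implicit.
Unset Printing Implicit Defensive.

Import GRing.Theory.
Import passmx.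

Local Open Scope ring_scope.

(* [tensv U V] is the coordinate model of U (x) V: the matrix t stands for the
   sum of the [t i j *: (e_i (x) f_j)], with e = [vbasis {:U}] and
   f = [vbasis {:V}]. Lemmas [tens_pure_bilinear], [tens_lift_linear],
   [tens_lift_pure] and [tens_ext] are its universal property. *)

Definition tensv (K : fieldType) (U V : vectType K) : vectType K :=
  'M[K]_(\dim {:U}, \dim {:V}).

Definition tens_pure (K : fieldType) (U V : vectType K) (u : U) (v : V) :
    tensv U V :=
  \matrix_(i, j) (coord (vbasis {:U}) i u * coord (vbasis {:V}) j v).

Notation "u \ot v" := (tens_pure u v)
  (at level 40, left associativity) : ring_scope.

(* For bilinear f, the linear map on U (x) V with u (x) v |-> f u v. *)
Definition tens_lift (K : fieldType) (U V W : vectType K) (f : U -> V -> W)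
    (t : tensv U V) : W :=
  \sum_(i < \dim {:U}) \sum_(j < \dim {:V})
    (t : 'M[K]_(\dim {:U}, \dim {:V})) i j *:
      f (vbasis {:U})`_i (vbasis {:V})`_j.

Definition tens_map (K : fieldType) (U V U' V' : vectType K)
    (f : U -> U') (g : V -> V') : tensv U V -> tensv U' V' :=
  tens_lift (fun u v => f u \ot g v).

Definition tens_assoc (K : fieldType) (U V W : vectType K) :
    tensv (tensv U V) W -> tensv U (tensv V W) :=
  tens_lift (fun s w => tens_lift (fun u v => u \ot (v \ot w)) s).

(* (a (x) b) (c (x) d) = ac (x) bd *)
Definition tens_mul (K : fieldType) (A B : falgType K) (s t : tensv A B) :
    tensv A B :=
  tens_lift (fun a b => tens_lift (fun c d => (a * c) \ot (b * d)) t) s.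

Definition bilinear_fun (K : fieldType) (U V W : vectType K)
    (f : U -> V -> W) : Prop :=
  (forall v, linear (f^~ v)) /\ (forall u, linear (f u)).

Section TensorTheory.

Variables (K : fieldType) (U V W : vectType K).

Lemma tens_pure_bilinear : bilinear_fun (@tens_pure K U V).
Proof.
split=> [v|u] a x y; apply/matrixP=> i j; rewrite !mxE linearP /=.
  by rewrite mulrDl mulrA.
by rewrite mulrDr mulrCA.
Qed.

Lemma tens_lift_linear (f : U -> V -> W) : linear (tens_lift f).
Proof.
move=> a s t; rewrite /tens_lift scaler_sumr -big_split /=.
apply: eq_bigr => i _; rewrite scaler_sumr -big_split /=.
by apply: eq_bigr => j _; rewrite !mxE scalerDl scalerA.
Qed.

HB.instance Definition _ (f : U -> V -> W) :=
  GRing.isLinear.Build K (tensv U V) W *:%R (tens_lift f) (tens_lift_linear f).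

Lemma tens_pure_basis (i : 'I_(\dim {:U})) (j : 'I_(\dim {:V})) :
  (vbasis {:U})`_i \ot (vbasis {:V})`_j = delta_mx i j :> 'M_(_, _).
Proof.
apply/matrixP=> i' j'; rewrite !mxE.
rewrite !coord_free ?(basis_free (vbasisP _)) // -natrM mulnb.
by rewrite [i == _]eq_sym [j == _]eq_sym.
Qed.

Lemma tens_lift_pure (f : U -> V -> W) (u : U) (v : V) :
  bilinear_fun f -> tens_lift f (u \ot v) = f u v.
Proof.
case=> fl fr.
pose Fl := GRing.isLinear.Build K U W *:%R (f^~ v) (fl v).
pose gl : {linear U -> W} := HB.pack (f^~ v) Fl.
rewrite {2}(coord_vbasis (memvf u)) -[RHS]/(gl _) linear_sum.
apply: eq_bigr => i _; rewrite linearZ /=.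
pose ei := (vbasis {:U})`_i.
pose Fr := GRing.isLinear.Build K V W *:%R (f ei) (fr ei).
pose gr : {linear V -> W} := HB.pack (f ei) Fr.
rewrite {2}(coord_vbasis (memvf v)) -[f _ _ in RHS]/(gr _) linear_sum.
rewrite scaler_sumr; apply: eq_bigr => j _.
by rewrite linearZ /= scalerA mxE.
Qed.

Lemma tens_ext (f g : {linear tensv U V -> W}) :
  (forall u v, f (u \ot v) = g (u \ot v)) -> f =1 g.
Proof.
move=> fg t; rewrite [t](@matrix_sum_delta _ (\dim {:U}) (\dim {:V})).
rewrite 2!linear_sum; apply: eq_bigr => i _.
rewrite 2!linear_sum; apply: eq_bigr => j _.
by rewrite !linearZ /= -tens_pure_basis fg.
Qed.

End TensorTheory.

Definition coassociative (K : fieldType) (C : vectType K)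
    (delta : 'Hom(C, tensv C C)) : Prop :=
  forall x, tens_assoc (tens_map delta id (delta x)) = tens_map id delta (delta x).

Definition counital (K : fieldType) (C : vectType K)
    (delta : 'Hom(C, tensv C C)) (eps : 'Hom(C, K^o)) : Prop :=
  (forall x, tens_lift (fun a b => (eps a : K) *: b) (delta x) = x) /\
  (forall x, tens_lift (fun a b => (eps b : K) *: a) (delta x) = x).

Record hopf_algebra (K : fieldType) (H : falgType K) := HopfAlgebra {
  comul : 'Hom(H, tensv H H);
  counit : 'Hom(H, K^o);
  antipode : 'End(H);
  comulA : coassociative comul;
  comul_counit : counital comul counit;
  comul1 : comul 1 = 1 \ot 1;
  comulM : forall x y, comul (x * y) = tens_mul (comul x) (comul y);
  counit1 : counit 1 = 1;
  counitM : forall x y, counit (x * y) = counit x * counit y;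
  antipodeL : forall x,
    tens_lift (fun a b => antipode a * b) (comul x) = (counit x : K) *: 1;
  antipodeR : forall x,
    tens_lift (fun a b => a * antipode b) (comul x) = (counit x : K) *: 1
}.

Definition left_ideal (K : fieldType) (A : falgType K) (I : {vspace A}) : bool :=
  (fullv * I <= I)%VS.

(* The left regular module is completely reducible. *)
Definition semisimple_alg (K : fieldType) (A : falgType K) : Prop :=
  forall I : {vspace A}, left_ideal I ->
    exists J : {vspace A},
      [/\ left_ideal J, (I + J = fullv)%VS & (I :&: J = 0)%VS].

Definition lfun_trace (K : fieldType) (V : vectType K) (f : 'End(V)) : K :=
  \tr (mxof (vbasis {:V}) (vbasis {:V}) f).

Lemma lfun_trace_basis (K : fieldType) (V : vectType K) (f : 'End(V))
    (e : (\dim {:V}).-tuple V) :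
  basis_of {:V} e -> lfun_trace f = \tr (mxof e e f).
Proof.
move=> eb; have vb := vbasisP {:V}.
rewrite /lfun_trace -{1}(comp_lfun1r f) (mxof_comp _ _ eb) mxtrace_mulC.
by rewrite -(mxof_comp _ _ vb) comp_lfun1l.
Qed.

(* Main.v *)
(* Write T = S^2, let lambda be a nonzero left integral of the dual of H, let g be
   the distinguished group-like element, lambda(x_1) x_2 = lambda(x) g, and let
   alpha be the character such that T o (alpha -> _) is the Nakayama automorphism
   of lambda. Comparing the two invariance properties of lambda under this
   automorphism gives Radford's formula T^2 P = Q, where P x = g (alpha -> x) and
   Q x = (x <- alpha) g are commuting operators.

   If H is not semisimple, every left integral of H has counit zero (Maschke), and
   evaluating characters at the left integrals produced by the trace shows
   Tr(T P^i) = Tr(T Q^i) = 0 for all i. If moreover P^r = Q^r = 1 for an odd prime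
   r, these relations diagonalize simultaneously; the signed multiplicities of the
   eigenvalues of T^r on the joint eigenspaces of P and Q are then related by
   vanishing sums of r-th roots of unity, so all r^2 of them are equal and
   Tr(T^r) = r^2 d. The Nakayama automorphism has determinant 1, because it relates
   a nondegenerate bilinear form to its transpose; hence det(T^r) = 1, the
   eigenvalue -1 of the involution T^r has even multiplicity, and Tr(T^r) is
   congruent to dim H modulo 4.

   Finally g and alpha have order dividing pq (the eigenvalue multiplicities of
   multiplication by g form an idempotent for convolution up to a factor). Were
   one of the orders pq, or the two orders p and q, there would be an operator
   commuting with T, with one-dimensional eigenspaces, on each of which T would
   have trace 0; so both orders divide the same prime r. The case r = q > p is
   impossible, since then |Tr(T^q)| < q^2 would force d = 0, whereas Tr(T^q) is
   odd. *)

From HB Require Import structures.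
From mathcomp Require Import all_solvable zify ring.
Require Import Defs.

Set Implicit Arguments.
Unset Strict Implicit.
Unset Printing Implicit Defensive.

Import GRing.Theory.
Local Open Scope ring_scope.

(** * Roots of unity *)

Section Roots.
Variable k : closedFieldType.
Hypothesis char0 : [pchar k] =i pred0.

Lemma natr_neq0 n : (0 < n)%N -> n%:R != 0 :> k.
Proof. by move=> n0; rewrite (pcharf0P _).1 // -lt0n. Qed.

Lemma prim_root_exists n : (0 < n)%N -> {z : k | n.-primitive_root z}.
Proof.
move=> n0.
have [rs def_rs] := closed_field_poly_normal ('X^n - 1 : {poly k}).
have lc : lead_coef ('X^n - 1 : {poly k}) = 1 by apply/eqP/monicXnsubC.
rewrite lc scale1r in def_rs.
have urs : uniq rs.
  rewrite -separable_prod_XsubC -def_rs separable_Xn_sub_1 //.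
  exact: natr_neq0.
have srs : size rs = n.
  have := congr1 (fun p : {poly k} => size p) def_rs.
  by rewrite size_XnsubC // size_prod_XsubC => -[].
have ars : all n.-unity_root rs.
  by apply/allP=> z zrs; rewrite /root_of_unity -root_prod_XsubC -def_rs in zrs *.
have := has_prim_root n0 ars urs; rewrite srs leqnn => /(_ isT).
by move=> h; have /hasP/sig2W[z _ pz] := h; exists z.
Qed.

Lemma sum_expr_unity n (z : k) : z ^+ n = 1 ->
  \sum_(i < n) z ^+ i = if z == 1 then n%:R else 0.
Proof.
case: eqP => [-> _|/eqP z1 zn].
  by under eq_bigr do rewrite expr1n; rewrite sumr_const card_ord.
apply/eqP; have := subrX1 z n; rewrite zn subrr => /esym/eqP.
by rewrite mulf_eq0 subr_eq0 (negPf z1).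
Qed.

(** Fourier inversion on the [n]-th roots of unity: weighting the [i]-th relation by [z^-1 ^+ i] and
    summing over [i < n] leaves [n] times the part of the sum where [u l = z]. *)
Lemma fourier_separate (I : finType) n (z : k) (f u : I -> k) :
    (0 < n)%N -> (forall l, u l ^+ n = 1) -> z ^+ n = 1 ->
    (forall i, \sum_l f l * u l ^+ i = 0) ->
  \sum_(l | u l == z) f l = 0.
Proof.
move=> n0 un zn fu; have z0 : z != 0.
  by apply: contra_eqN zn => /eqP->; rewrite expr0n (gtn_eqF n0) eq_sym oner_eq0.
have: \sum_(i < n) z^-1 ^+ i * (\sum_l f l * u l ^+ i) = 0.
  by apply: big1 => i _; rewrite fu mulr0.
under eq_bigr => i _ do rewrite big_distrr.
rewrite exchange_big /= => h.
apply/eqP; rewrite -(mulrI_eq0 _ (mulfI (natr_neq0 n0))); apply/eqP.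
rewrite mulr_sumr big_mkcond -[RHS]h; apply: eq_bigr => l _.
under eq_bigr => i _ do rewrite mulrCA -exprMn.
rewrite -mulr_sumr sum_expr_unity; last first.
  by rewrite exprMn exprVn zn un invr1 mulr1.
rewrite -(inj_eq (mulfI z0) (z^-1 * _)) mulVKf // mulr1.
by case: ifP => _; rewrite ?mulr0 // mulrC.
Qed.

Lemma natr_inj_char0 : injective (fun n : nat => n%:R : k).
Proof.
move=> a b /= h.
wlog le_ab : a b h / (a <= b)%N.
  move=> H; case: (leqP a b) => [|/ltnW] ab; first exact: H.
  by apply/esym/H.
apply/eqP; rewrite eqn_leq le_ab /= -subn_eq0 -[_ == _]((pcharf0P _).1 char0).
by rewrite natrB // h subrr.
Qed.

Lemma intr_eq0_char0 (m : int) : (m%:~R == 0 :> k) = (m == 0).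
Proof.
case: m => n; first by rewrite -pmulrn ((pcharf0P _).1 char0).
by rewrite NegzE mulrNz oppr_eq0 -pmulrn ((pcharf0P _).1 char0).
Qed.

Lemma intr_inj_char0 : injective (fun m : int => m%:~R : k).
Proof.
move=> a b /= /eqP; rewrite -subr_eq0 -rmorphB intr_eq0_char0 subr_eq0.
by move/eqP.
Qed.

(* [f] and [Phi] have a common root in [algC] unless they satisfy a Bezout
   relation over the integers, which [z] would violate; at a common root the
   minimal polynomial over the rationals is cyclotomic of degree [r - 1]. *)
Lemma prime_root_relation r (z : k) (x : nat -> int) : prime r ->
    r.-primitive_root z -> \sum_(i < r) (x i)%:~R * z ^+ i = 0 ->
  forall i, (i < r)%N -> x i = x 0.
Proof.
move=> pr_r prim_z xz0.
have r1 := prime_gt1 pr_r; have r0 := prime_gt0 pr_r.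
pose f : {poly int} := \poly_(i < r) x i.
pose Phi : {poly int} := \poly_(i < r) 1.
have horner_sum (R : comNzRingType) (y : nat -> int) (c : R) :
    (map_poly intr (\poly_(i < r) y i)).[c] = \sum_(i < r) (y i)%:~R * c ^+ i.
  rewrite poly_def rmorph_sum horner_sum; apply: eq_bigr => i _.
  by rewrite /= -mul_polyC rmorphM /= map_polyC map_polyXn hornerM hornerC hornerXn.
have z_n1 : z != 1.
  apply/eqP => z1; have := prim_order_dvd prim_z 1.
  by rewrite z1 expr1n eqxx dvdn1 => /eqP r_1; rewrite r_1 in r1.
have rootPhi (R : idomainType) (c : R) : c ^+ r = 1 -> c != 1 ->
    (map_poly intr Phi).[c] = 0.
  move=> cr c1; rewrite horner_sum.
  apply/eqP; rewrite -(mulrI_eq0 _ (mulfI (_ : c - 1 != 0))) ?subr_eq0 //.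
  under eq_bigr do rewrite mul1r.
  by rewrite -subrX1 cr subrr.
have [/Bezout_coprimepP[[u v] /eqpP[[a b] /=/andP[a0 b0]]] | ncop] :=
    boolP (coprimep f Phi).
  move=> /(congr1 (fun p => (map_poly (intr : int -> k) p).[z])).
  rewrite !linearZ /= !hornerZ rmorphD !rmorphM !hornerE horner_sum xz0.
  rewrite rootPhi ?(prim_expr_order prim_z) // !mulr0 addr0 mulr0.
  by rewrite rmorph1 hornerC mulr1 => /esym/eqP; rewrite intr_eq0_char0 (negPf b0).
pose g := gcdp f Phi.
have [c root_g] : exists c : algC, root (map_poly intr g) c.
  apply/closed_rootP; rewrite size_map_poly_id0 ?intr_eq0 ?lead_coef_eq0.
    by rewrite -coprimep_def.
  apply/eqP=> g0; have : gcdp f Phi == 0 by apply/eqP.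
  rewrite gcdp_eq0 => /andP[_ /eqP /(congr1 (fun p : {poly int} => p`_0))].
  by rewrite coef_poly r0 coef0.
have root_of (h : {poly int}) : g %| h -> root (map_poly intr h) c.
  case/Pdiv.Idomain.dvdpP=> -[a w] /= a0 /(congr1 (map_poly (intr : int -> algC))).
  rewrite linearZ rmorphM /= => /(congr1 (horner^~ c)).
  rewrite hornerM (eqP root_g) mulr0 hornerZ => /eqP.
  by rewrite mulf_eq0 intr_eq0 (negPf a0).
have f_c := root_of _ (dvdp_gcdl f Phi); have Phi_c := root_of _ (dvdp_gcdr f Phi).
have prim_c : r.-primitive_root c.
  have c_r : c ^+ r = 1.
    apply/eqP; rewrite -subr_eq0 subrX1.
    move: Phi_c; rewrite /root horner_sum => /eqP h.
    rewrite (_ : \sum_(i < r) c ^+ i = 0) ?mulr0 // -[RHS]h.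
    by apply: eq_bigr => i _; rewrite mul1r.
  have [m prim_m m_r] := prim_order_exists r0 c_r.
  have /primeP[_ /(_ _ m_r)/orP[/eqP m1|/eqP <- //]] := pr_r.
  have c1 : c = 1 by rewrite -(prim_expr_order prim_m) m1 expr1.
  move: Phi_c; rewrite /root horner_sum c1.
  under eq_bigr do rewrite expr1n mulr1.
  by rewrite sumr_const card_ord Num.Theory.pnatr_eq0 (gtn_eqF r0).
have [p [minp mon_p dvd_p]] : exists p : {poly rat},
    [/\ minCpoly c = map_poly ratr p, p \is monic &
        forall h : {poly rat}, root (map_poly ratr h) c = (p %| h)].
  by have [p [minp mon_p dvd_p]] := minCpolyP c; exists p.
have size_p : size p = r.
  have := congr1 (fun q : {poly algC} => size q) minp.
  rewrite (minCpoly_cyclotomic prim_c) size_cyclotomic totient_prime // prednK //.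
  by rewrite size_map_poly.
(* As [p] has size [r], a polynomial of size at most [r] vanishing at [c] is a constant times [p].
   This applies to [f] and to [Phi], whose coefficients are all 1. *)
have multiple (y : nat -> int) : root (map_poly intr (\poly_(i < r) y i)) c ->
    exists a : rat, forall i, (i < r)%N -> (y i)%:~R = a * p`_i.
  set h := \poly_(i < r) y i.
  have -> : map_poly (intr : int -> algC) h =
      map_poly ratr (map_poly (intr : int -> rat) h).
    by rewrite -map_poly_comp /=; apply: eq_map_poly => m /=; rewrite ratr_int.
  rewrite dvd_p => /dvdpP[w def_h]; exists w`_0 => i ir.
  have w1 : (size w <= 1)%N.
    have [->|w0] := eqVneq w 0; first by rewrite size_poly0.
    have : (size (w * p)%R <= r)%N.
      by rewrite -def_h (leq_trans (size_poly _ _)) // size_poly.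
    have -> : size (w * p)%R = (size w + r).-1.
      by rewrite -size_p; apply: size_mul w0 (monic_neq0 mon_p).
    rewrite -subn1.
    by rewrite leq_subLR leq_add2r.
  have := congr1 (fun q : {poly rat} => q`_i) def_h.
  by rewrite [in RHS](size1_polyC w1) coefCM coef_map coef_poly ir.
have [a fa] := multiple _ f_c; have [b Phib] := multiple _ Phi_c.
have b0 : b != 0.
  by apply: contra_eqN (Phib 0 r0) => /eqP->; rewrite mul0r oner_eq0.
move=> i ir; apply/eqP; rewrite -(eqr_int rat); apply/eqP.
rewrite !fa //; congr (_ * _); apply: (mulfI b0).
by rewrite -!Phib.
Qed.

(** Grouping the weights by the pair of exponents gives an [r] by [r] table [x]. By
    [prime_root_relation] the hypotheses make it constant along rows and along columns, so its
    [r ^ 2] entries agree. *)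
Lemma double_sum_constant r n (al bl : 'I_n -> 'I_r) (w : 'I_n -> int) (z z' : k) :
    prime r -> r.-primitive_root z -> r.-primitive_root z' ->
    (forall a, \sum_(l | al l == a) (w l)%:~R * z ^+ bl l = 0) ->
    (forall b, \sum_(l | bl l == b) (w l)%:~R * z' ^+ al l = 0) ->
  exists d : int, \sum_l w l = (r ^ 2)%:R * d.
Proof.
move=> pr_r prim_z prim_z' rowz colz; have r0 := prime_gt0 pr_r.
pose x (i j : nat) := \sum_(l | (al l == i :> nat) && (bl l == j :> nat)) w l.
have xcol i j : (i < r)%N -> (j < r)%N -> x i j = x i 0.
  move=> ir jr; apply: (prime_root_relation pr_r prim_z) => //.
  rewrite -[RHS](rowz (Ordinal ir)) (partition_big bl predT) //=.
  apply: eq_bigr => b _; rewrite /x rmorph_sum mulr_suml /=.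
  by apply: eq_big => l //= /andP[_ /eqP->].
have xrow i j : (i < r)%N -> (j < r)%N -> x i j = x 0 j.
  move=> ir jr; pose y i' := x i' j; rewrite -[LHS]/(y i).
  apply: (prime_root_relation pr_r prim_z') => //.
  rewrite -[RHS](colz (Ordinal jr)) (partition_big al predT) //=.
  apply: eq_bigr => b _; rewrite /y /x rmorph_sum mulr_suml /=.
  by apply: eq_big => [l|l /andP[/eqP-> _]] //=; rewrite andbC.
exists (x 0 0).
rewrite (partition_big al predT) //=.
under eq_bigr => i _ do rewrite (partition_big bl predT) //=.
transitivity (\sum_(i < r) \sum_(j < r) x 0 0).
  apply: eq_bigr => i _; apply: eq_bigr => j _.
  by rewrite -(xrow i 0) // -(xcol i j).
by rewrite !sumr_const !card_ord -mulrnA mulnn mulr_natl.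
Qed.

(** Here [t], [p], [q] stand for joint eigenvalues of [T], [P], [Q]. Up to the sign [t l ^+ r], the
    value [t l] is determined by [p l] and [q l], and [fourier_separate] brings the relations into
    the form required by [double_sum_constant]. *)
Lemma sum_expr_prime_square r n (t p q : 'I_n -> k) : prime r -> odd r ->
    (forall l, p l ^+ r = 1) -> (forall l, q l ^+ r = 1) ->
    (forall l, t l ^+ 2 * p l = q l) ->
    (forall i, \sum_l t l * p l ^+ i = 0) ->
    (forall i, \sum_l t l * q l ^+ i = 0) ->
  exists d : int, \sum_l t l ^+ r = (r ^ 2)%:R * d%:~R.
Proof.
move=> pr_r odd_r pr qr tpq tp tq; have r0 := prime_gt0 pr_r.
have [z prim_z] := prim_root_exists r0.
have r_half : r = (r./2.*2).+1 by rewrite -[LHS]odd_double_half odd_r.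
have prim_z2 : r.-primitive_root (z ^+ 2).
  by rewrite prim_root_exp_coprime // coprime_sym coprimen2.
have prim_z' : r.-primitive_root (z ^+ r.-1).
  by rewrite prim_root_exp_coprime // coprime_sym -{1}(prednK r0) coprimeSn.
(* Exponents refer to [z ^+ 2] so that [q l / p l] has an explicit square root in terms of [z] and
   its inverse [z ^+ r.-1]. *)
pose al l := sval (prim_rootP prim_z2 (pr l)).
pose bl l := sval (prim_rootP prim_z2 (qr l)).
have pE l : p l = (z ^+ 2) ^+ al l by rewrite /al; case: prim_rootP.
have qE l : q l = (z ^+ 2) ^+ bl l by rewrite /bl; case: prim_rootP.
have w2 l : t l ^+ r ^+ 2 = 1.
  have := congr1 (fun x => x ^+ r) (tpq l); rewrite exprMn pr qr mulr1.
  by rewrite -!exprM mulnC.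
pose w l : int := if t l ^+ r == 1 then 1 else - 1.
have wE l : (w l)%:~R = t l ^+ r.
  rewrite /w; case: eqP => [-> //|/eqP w1]; have /eqP := w2 l.
  by rewrite sqrf_eq1 (negPf w1) /= => /eqP->; rewrite rmorphN.
have tE l : t l = (w l)%:~R * z ^+ bl l * (z ^+ r.-1) ^+ al l.
  have t2 : t l ^+ 2 = q l * p l ^+ r.-1.
    by rewrite -tpq -mulrA -exprS prednK // pr mulr1.
  (* Since [r] is odd, [r./2.+1] is the inverse of 2 modulo [r]. *)
  have half_exp (m : nat) : ((z ^+ 2) ^+ m) ^+ r./2.+1 = z ^+ m.
    rewrite -!exprM; have -> : (2 * (m * r./2.+1) = r * m + m)%N.
      by rewrite {2}r_half; lia.
    by rewrite exprD exprM (prim_expr_order prim_z) expr1n mul1r.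
  (* The total exponent on the right is [2 * r + 1], and [t l ^+ (2 * r) = 1]. *)
  have -> : t l = t l ^+ r * (t l ^+ 2) ^+ r./2.+1.
    rewrite -exprM -exprD (_ : (r + 2 * r./2.+1 = r * 2 + 1)%N).
      by rewrite exprD exprM w2 mul1r.
    by rewrite {1 3}r_half; lia.
  rewrite t2 wE -mulrA; congr (_ * _); rewrite exprMn qE pE half_exp.
  by rewrite -[_ ^+ al l ^+ r.-1]exprM half_exp mulnC exprM.
have eqprim (i j : 'I_r) : ((z ^+ 2) ^+ i == (z ^+ 2) ^+ j) = (i == j).
  by rewrite (eq_prim_root_expr prim_z2) !modn_small.
have z'0 m : (z ^+ r.-1) ^+ m != 0.
  rewrite !expf_neq0 //; apply: contra_eqN (prim_expr_order prim_z) => /eqP->.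
  by rewrite expr0n (gtn_eqF r0) eq_sym oner_eq0.
have z0 m : z ^+ m != 0.
  rewrite !expf_neq0 //; apply: contra_eqN (prim_expr_order prim_z) => /eqP->.
  by rewrite expr0n (gtn_eqF r0) eq_sym oner_eq0.
have [a|b|d sum_w] := double_sum_constant (al := al) (bl := bl) (w := w)
  pr_r prim_z prim_z'.
- apply: (mulIf (z'0 a)); rewrite mul0r mulr_suml.
  rewrite -[RHS](fourier_separate (z := (z ^+ 2) ^+ a) r0 pr _ tp).
    apply: eq_big => l; first by rewrite pE eqprim.
    by move/eqP<-; rewrite -tE.
  by rewrite exprAC (prim_expr_order prim_z2) expr1n.
- apply: (mulIf (z0 b)); rewrite mul0r mulr_suml.
  rewrite -[RHS](fourier_separate (z := (z ^+ 2) ^+ b) r0 qr _ tq).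
    apply: eq_big => l; first by rewrite qE eqprim.
    by move/eqP<-; rewrite mulrAC -tE.
  by rewrite exprAC (prim_expr_order prim_z2) expr1n.
exists d; under eq_bigr => l _ do rewrite -wE.
by rewrite -rmorph_sum /= sum_w rmorphM /= rmorph_nat.
Qed.

End Roots.

(** * Matrices of finite order *)

Section DiagonalForm.
Variables (k : closedFieldType) (n : nat) (X : 'M[k]_n).
Implicit Types (A B : 'M[k]_n) (d e : 'I_n -> k).

(** The rows of [X] are left eigenvectors of [A]. Written without [invmx X], the relation passes to
    products and powers before [X] is assumed invertible. *)
Definition diag_in A d := X *m A = diag_mx (\row_l d l) *m X.

Lemma diag_in_mul A B d e :
  diag_in A d -> diag_in B e -> diag_in (A * B) (fun l => d l * e l).
Proof.
move=> dA eB; rewrite /diag_in mulmxA dA -mulmxA eB mulmxA mulmx_diag.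
by congr (diag_mx _ *m _); apply/rowP=> l; rewrite !mxE.
Qed.

Lemma diag_in_exp A d i : diag_in A d -> diag_in (A ^+ i) (fun l => d l ^+ i).
Proof.
move=> dA; elim: i => [|i IHi]; last first.
  rewrite exprS; have := diag_in_mul dA IHi.
  by congr (_ = diag_mx _ *m _); apply/rowP=> l; rewrite !mxE exprS.
rewrite /diag_in mulmx1 (_ : diag_mx _ = 1%:M) ?mul1mx //.
by apply/matrixP=> i j; rewrite !mxE.
Qed.

Hypothesis unitX : X \in unitmx.

Lemma diag_in_inj A d e : diag_in A d -> diag_in A e -> d =1 e.
Proof.
rewrite /diag_in => -> /(can_inj (mulmxK unitX)) /matrixP de l.
by have := de l l; rewrite !mxE eqxx !mulr1n.
Qed.

Lemma diag_in1 : diag_in 1 (fun=> 1).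
Proof.
rewrite /diag_in mulmx1 (_ : diag_mx _ = 1%:M) ?mul1mx //.
by apply/matrixP=> i j; rewrite !mxE.
Qed.

Lemma diag_in_conj A d : diag_in A d -> A = invmx X *m diag_mx (\row_l d l) *m X.
Proof. by move=> dA; rewrite -mulmxA -dA mulKmx. Qed.

Lemma diag_in_trace A d : diag_in A d -> \tr A = \sum_l d l.
Proof.
move/diag_in_conj->; rewrite mxtrace_mulC mulmxA mulmxV // mul1mx mxtrace_diag.
by apply: eq_bigr => l _; rewrite mxE.
Qed.

Lemma diag_in_det A d : diag_in A d -> \det A = \prod_l d l.
Proof.
move/diag_in_conj->; rewrite !det_mulmx mulrC mulrA -det_mulmx mulmxV //.
by rewrite det1 mul1r det_diag; apply: eq_bigr => l _; rewrite mxE.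
Qed.

End DiagonalForm.

Lemma sum_nat_card (I : finType) (a : pred I) : (\sum_i a i)%N = #|a|.
Proof.
rewrite -sum1_card [RHS]big_mkcond.
by apply: eq_bigr => i _; rewrite unfold_in; case: (a i).
Qed.

Section FiniteOrder.
Variable k : closedFieldType.
Hypothesis char0 : [pchar k] =i pred0.

(** The minimal polynomial divides ['X^N - 1], which splits with simple roots in characteristic
    0. *)
Lemma finite_order_diagonalizable n N (A : 'M[k]_n) :
  (0 < N)%N -> A ^+ N = 1 -> diagonalizable A.
Proof.
case: n A => [|n] A N0 AN; first by rewrite [A]flatmx0; apply: diagonalizable0.
apply/diagonalizableP.
have [rs def_rs] := closed_field_poly_normal ('X^N - 1 : {poly k}).
have lc : lead_coef ('X^N - 1 : {poly k}) = 1 by apply/eqP/monicXnsubC.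
rewrite lc scale1r in def_rs; exists rs.
  rewrite -separable_prod_XsubC -def_rs separable_Xn_sub_1 //.
  exact: natr_neq0.
rewrite -def_rs; apply: mxminpoly_min.
by rewrite rmorphB rmorphXn /= horner_mx_X rmorph1 AN subrr.
Qed.

Lemma finite_order_codiagonalizable n N (As : seq 'M[k]_n) : (0 < N)%N ->
    {in As, forall A, A ^+ N = 1} -> {in As &, forall A B, A * B = B * A} ->
  exists2 X, X \in unitmx & {in As, forall A, exists d, diag_in X A d}.
Proof.
move=> N0 AsN comAs.
have [|X uX /allP diagX] := (codiagonalizableP As).1.
  by split=> // A /AsN; apply: finite_order_diagonalizable.
exists X => // A /diagX /=/diagonalizable_forPex[D /(simmxP uX) dA].
exists (fun l => D 0 l); rewrite /diag_in dA; congr (diag_mx _ *m _).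
by apply/rowP=> l; rewrite mxE.
Qed.

Lemma trace_expr_prime_square n r (T P Q : 'M[k]_n) : prime r -> odd r ->
    T * P = P * T -> T * Q = Q * T -> P * Q = Q * P ->
    P ^+ r = 1 -> Q ^+ r = 1 -> T ^+ 2 * P = Q ->
    (forall i, \tr (T * P ^+ i) = 0) -> (forall i, \tr (T * Q ^+ i) = 0) ->
  exists d : int, \tr (T ^+ r) = (r ^ 2)%:R * d%:~R.
Proof.
move=> pr_r odd_r TP TQ PQ Pr Qr T2P trP trQ; have r0 := prime_gt0 pr_r.
(* The [r]-th power of [T ^+ 2 * P = Q] eliminates [P] and [Q]; hence [T] has finite order too, and
   the three operators diagonalize together. *)
have T2r : T ^+ (2 * r) = 1.
  have := congr1 (fun A => A ^+ r) T2P; rewrite Qr exprMn_comm ?Pr ?mulr1 -?exprM //.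
  by rewrite /GRing.comm; apply/esym/commrX.
have [|||X uX dX] := @finite_order_codiagonalizable n (2 * r) [:: T; P; Q].
- by rewrite muln_gt0.
- move=> A; rewrite !inE => /or3P[]/eqP-> //; by rewrite mulnC exprM ?Pr ?Qr expr1n.
- by move=> A B; rewrite !inE => /or3P[]/eqP-> /or3P[]/eqP->.
have [[t dT] [p dP] [q dQ]] : [/\ exists t, diag_in X T t, exists p, diag_in X P p
    & exists q, diag_in X Q q] by split; apply: dX; rewrite !inE eqxx ?orbT.
have d1 := diag_in1 X.
have [|||i|i|d sum_d] := @sum_expr_prime_square k char0 r n t p q pr_r odd_r.
- by apply: (diag_in_inj uX (diag_in_exp r dP)); rewrite Pr.
- by apply: (diag_in_inj uX (diag_in_exp r dQ)); rewrite Qr.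
- apply: (diag_in_inj uX (A := Q)) => //.
  by rewrite -T2P; apply: diag_in_mul (diag_in_exp 2 dT) dP.
- by rewrite -[RHS](trP i) (diag_in_trace uX (diag_in_mul dT (diag_in_exp i dP))).
- by rewrite -[RHS](trQ i) (diag_in_trace uX (diag_in_mul dT (diag_in_exp i dQ))).
by exists d; rewrite (diag_in_trace uX (diag_in_exp r dT)).
Qed.

(** The determinant is -1 to the multiplicity of the eigenvalue -1. That multiplicity is therefore
    some [2 * m], and each eigenvalue -1 lowers the trace [n] of the identity by 2. *)
Lemma trace_involution_det1 n (W : 'M[k]_n) : W ^+ 2 = 1 -> \det W = 1 ->
  exists2 m : nat, (4 * m <= 2 * n)%N & \tr W = n%:R - (4 * m)%:R.
Proof.
move=> W2 detW.
have [|||X uX dX] := @finite_order_codiagonalizable n 2 [:: W] => //.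
- by move=> A; rewrite inE => /eqP->.
- by move=> A B; rewrite !inE => /eqP-> /eqP->.
have [w dW] := dX W (mem_head _ _).
have w2 l : w l ^+ 2 = 1.
  by apply: (diag_in_inj uX (diag_in_exp 2 dW)); rewrite W2; apply: diag_in1.
pose neg := [pred l | w l == -1].
have wE l : w l = (-1) ^+ (neg l).
  rewrite /=; case: eqP => [->|/eqP w1]; first by rewrite expr1.
  by have /eqP := w2 l; rewrite sqrf_eq1 (negPf w1) orbF => /eqP.
have n10 : (-1 : k) != 1.
  rewrite -subr_eq0 -opprD oppr_eq0 -(natrD _ 1 1).
  exact: natr_neq0.
have even_neg : ~~ odd #|neg|.
  move: detW; rewrite (diag_in_det uX dW).
  under eq_bigr do rewrite wE.
  rewrite prodrXr -signr_odd sum_nat_card; case: (odd _) => //.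
  by rewrite expr1 => /eqP; rewrite (negPf n10).
have neg2 : (4 * #|neg|./2 = 2 * #|neg|)%N.
  by rewrite -[in RHS](odd_double_half #|neg|) (negPf even_neg); lia.
exists #|neg|./2; rewrite neg2.
  by rewrite leq_mul2l /= (leq_trans (max_card _)) ?card_ord.
rewrite (diag_in_trace uX dW).
have -> : n%:R = \sum_(l : 'I_n) 1 :> k by rewrite sumr_const card_ord.
have -> : (2 * #|neg|)%:R = \sum_(l : 'I_n) 2 * (neg l)%:R :> k.
  by rewrite -mulr_sumr -natr_sum sum_nat_card natrM.
rewrite -sumrB; apply: eq_bigr => l _; rewrite wE; case: (neg l) => /=.
  by rewrite expr1; ring.
by rewrite mulr0 subr0.
Qed.

End FiniteOrder.

(** With [E = C *m D] the full-rank factorization, [C] cancels on the left and [D] on the right in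
    [E *m E = E]. *)
Lemma idempotent_base (F : fieldType) n (E : 'M[F]_n) : E *m E = E ->
  row_base E *m col_base E = 1%:M.
Proof.
move=> EE; apply: (row_full_inj (col_base_full E)).
apply: (row_free_inj (row_base_free E)).
by rewrite mulmx1 mulmx_base mulmxA mulmx_base -mulmxA mulmx_base.
Qed.

(** * Traces of intertwined operators on matrix spaces *)

Section TraceTensor.
Variables (F : fieldType) (n : nat).

Lemma mxtrace_lin_mx (f : {linear 'M[F]_n -> 'M[F]_n}) :
  \tr (lin_mx f) = \sum_i \sum_j f (delta_mx i j) i j.
Proof.
rewrite /mxtrace (reindex _ (curry_mxvec_bij n n)) /= pair_bigA /=.
apply: eq_bigr => -[i j] _ /=.
by rewrite -[RHS]mxvecE -mul_vec_lin mxvec_delta -rowE [RHS]mxE.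
Qed.

(** [Phi] conjugates left multiplication by [C], of trace [n%:R * \tr C], into [X |-> D *m X *m E],
    of trace [\tr D * \tr E]. It serves with matrices read as elements of the tensor square of
    [H]. *)
Lemma mxtrace_mul_intertwine (Phi : {linear 'M[F]_n -> 'M[F]_n}) (C D E : 'M[F]_n) :
    injective Phi -> (forall X, Phi (C *m X) = D *m Phi X *m E) ->
  n%:R * \tr C = \tr D * \tr E.
Proof.
move=> injPhi PhiC.
pose f : {linear 'M[F]_n -> 'M[F]_n} := mulmx C.
pose g : {linear 'M[F]_n -> 'M[F]_n} := mulmxr E \o mulmx D.
have uPhi : lin_mx Phi \in unitmx.
  rewrite -row_free_unit -kermx_eq0; apply/rowV0P => v /sub_kermxP.
  rewrite -(vec_mxK v) mul_vec_lin => /(canRL mxvecK); rewrite linear0.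
  by rewrite -[RHS](linear0 Phi) => /injPhi ->; rewrite linear0.
have conj : lin_mx Phi *m lin_mx g = lin_mx f *m lin_mx Phi.
  apply/row_matrixP=> i; rewrite !rowE -(vec_mxK (delta_mx 0 i)) !mulmxA.
  by rewrite !mul_vec_lin /= -PhiC.
have : \tr (lin_mx g) = \tr (lin_mx f).
  rewrite -[lin_mx g](mulKmx uPhi) conj mxtrace_mulC -mulmxA mulmxV //.
  by rewrite mulmx1.
rewrite !mxtrace_lin_mx /f /g /=.
have entry (A B : 'M[F]_n) i j : (A *m delta_mx i j *m B) i j = A i i * B j j.
  rewrite -mulmxA mxE (bigD1 i) //= big1 ?addr0.
    rewrite mxE (bigD1 j) //= big1 ?addr0 => [|l lj].
      by rewrite mxE !eqxx mul1r.
    by rewrite mxE (negPf lj) andbF mul0r.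
  move=> l li; rewrite mxE big1 ?mulr0 // => m _.
  by rewrite mxE (negPf li) mul0r.
under eq_bigr => i _ do under eq_bigr => j _ do rewrite entry.
under [RHS]eq_bigr => i _ do
  under eq_bigr => j _ do rewrite -[_ *m _]mulmx1 entry mxE eqxx mulr1.
rewrite /mxtrace big_distrlr /= => ->.
by rewrite mulr_sumr; apply: eq_bigr => i _; rewrite sumr_const card_ord mulr_natl.
Qed.

End TraceTensor.

Section Operators.
Variable k : closedFieldType.
Hypothesis char0 : [pchar k] =i pred0.

(* The averaging idempotent of [U] has rank 1, so [T] acts by its trace 0 on it. *)
Lemma regular_operator_absurd n (T U : 'M[k]_n) : (0 < n)%N -> T \in unitmx ->
    T * U = U * T -> U ^+ n = 1 ->
    (forall i, (0 < i < n)%N -> \tr (U ^+ i) = 0) ->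
    (forall i, \tr (T * U ^+ i) = 0) -> False.
Proof.
move=> n0 uT TU Un trU trTU.
have nz := natr_neq0 char0 n0.
pose E := n%:R^-1 *: \sum_(i < n) U ^+ i.
have UE : U *m E = E.
  rewrite -scalemxAr; congr (_ *: _); have := subrX1 U n.
  by rewrite Un subrr mulrBl mul1r => /esym/eqP; rewrite subr_eq0 => /eqP.
have UiE i : U ^+ i *m E = E.
  elim: i => [|i IHi]; first by rewrite mul1mx.
  by rewrite exprSr -mulmxA UE.
have EE : E *m E = E.
  rewrite {1}/E -scalemxAl mulmx_suml.
  under eq_bigr do rewrite UiE.
  by rewrite sumr_const card_ord -scaler_nat scalerA mulVf // scale1r.
have trE : \tr E = 1.
  rewrite /E mxtraceZ raddf_sum /= (bigD1 (Ordinal n0)) //= big1 ?addr0.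
    by rewrite mxtrace1 mulVf.
  by move=> [[|i] lt_in] // _; apply: trU.
have trTE : \tr (T *m E) = 0.
  rewrite /E -scalemxAr mulmx_sumr mxtraceZ raddf_sum /= big1 ?mulr0 // => i _.
  exact: trTU.
have TE : T *m E = E *m T.
  rewrite -scalemxAr -scalemxAl mulmx_sumr mulmx_suml; congr (_ *: _).
  by apply: eq_bigr => i _; apply: (commrX i TU).
have DC := idempotent_base EE; have defE := mulmx_base E.
have rankE : \rank E = 1%N.
  apply: (natr_inj_char0 char0).
  by rewrite /= -[RHS]trE -{2}defE mxtrace_mulC DC mxtrace1.
move: (col_base E) (row_base E) DC defE; rewrite rankE => C D DC defE.
(* This 1 by 1 matrix describes [T] on the column space of [E]; it equals its trace
   [\tr (T *m E)]. *)
have : D *m T *m C = 0.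
  move: trTE; rewrite -defE mulmxA mxtrace_mulC mulmxA trace_mx11 => h.
  by rewrite [LHS]mx11_scalar h raddf0.
move=> DTC; have TC : T *m C = 0.
  rewrite -[C]mulmx1 -DC !mulmxA -(mulmxA T) defE TE -defE -!mulmxA.
  by rewrite (mulmxA D) DTC mulmx0.
have C0 : C = 0 by rewrite -[C](mulKmx uT) TC mulmx0.
by have /matrixP/(_ 0 0)/eqP := DC; rewrite C0 mulmx0 !mxE eq_sym oner_eq0.
Qed.

Lemma intertwine_exp n (U : 'M[k]_n) (Phi : {linear 'M[k]_n -> 'M[k]_n}) i X :
    (forall Y, Phi (U^T *m Y) = U^T *m Phi Y *m U) ->
  Phi ((U ^+ i)^T *m X) = (U ^+ i)^T *m Phi X *m (U ^+ i).
Proof.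
move=> PhiU; elim: i X => [|i IHi] X; first by rewrite trmx1 !mul1mx mulmx1.
by rewrite exprSr trmx_mul -!mulmxA PhiU IHi !mulmxA.
Qed.

(* Expanding [p(U)] for the minimal polynomial [p] on both sides of [Phi] shows
   that [U ^+ i = U ^+ j] whenever the [i]-th and [j]-th coefficients of [p] are
   nonzero; hence [p] is of the form ['X^N - 1]. *)
Lemma grouplike_operator_order n (U : 'M[k]_n) (Phi : {linear 'M[k]_n -> 'M[k]_n}) :
    (0 < n)%N -> U \in unitmx -> injective Phi ->
    (forall X, Phi (U^T *m X) = U^T *m Phi X *m U) ->
  exists N, [/\ (0 < N)%N, U ^+ N = 1 &
                forall z, z ^+ N = 1 -> eigenvalue U z].
Proof.
case: n U Phi => // n U Phi _ unitU injPhi PhiU.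
pose p := mxminpoly U; pose d := degree_mxminpoly U.
have size_p : size p = d.+1 by apply: size_mxminpoly.
have horner_sum (q : {poly k}) : (size q <= d.+1)%N ->
    horner_mx U q = \sum_(i < d.+1) q`_i *: U ^+ i.
  move=> sq; rewrite -[in LHS](coefK q) poly_def rmorph_sum /=.
  rewrite (big_ord_widen _ (fun i => horner_mx U (q`_i *: 'X^i)) sq) big_mkcond.
  apply: eq_bigr => i _; rewrite horner_mxZ rmorphXn /= horner_mx_X.
  by case: ltnP => // /leq_sizeP -> //; rewrite scale0r.
have p_d : p`_d = 1 by have /monicP := mxminpoly_monic U; rewrite lead_coefE size_p.
have U0 i : U ^+ i != 0.
  apply/eqP => Ui; have : U ^+ i \is a GRing.unit by apply: unitrX.
  by rewrite Ui unitr0.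
(* Every [Y] is [Phi (Psi Y)], so applying [Phi] to the product of the transpose of [p(U) = 0] with
   [Psi Y] gives the relation. *)
have sum0 Y : \sum_(i < d.+1) p`_i *: ((U ^+ i)^T *m Y *m U ^+ i) = 0.
  have [Psi PhiK] : exists Psi, cancel Psi Phi.
    have uPhi : lin_mx Phi \in unitmx.
      rewrite -row_free_unit -kermx_eq0; apply/rowV0P => v /sub_kermxP.
      rewrite -(vec_mxK v) mul_vec_lin => /(canRL mxvecK); rewrite linear0.
      by rewrite -[RHS](linear0 Phi) => /injPhi ->; rewrite linear0.
    exists (fun Z => vec_mx (mxvec Z *m invmx (lin_mx Phi))) => Z.
    by apply: (can_inj mxvecK); rewrite -mul_vec_lin vec_mxK mulmxKV.
  have := congr1 (fun q => Phi (q^T *m Psi Y)) (horner_sum p (eq_leq size_p)).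
  rewrite /p mx_root_minpoly trmx0 mul0mx linear0 raddf_sum mulmx_suml raddf_sum.
  move=> h; rewrite [RHS]h; apply: eq_bigr => i _.
  by rewrite /= linearZ -scalemxAl linearZ intertwine_exp // PhiK.
have eq_pow i : p`_i != 0 -> U ^+ i = U ^+ d.
  move=> pi0; have ltid : (i < d.+1)%N.
    by rewrite ltnNge; apply: contra pi0 => /leq_sizeP -> //; rewrite size_p.
  apply/matrixP=> a c.
  (* The entries of [sum0] at matrix units say that [q] annihilates [U]. Its degree is at most [d],
     so it is a constant multiple of [p], and comparing coefficients shows that entry [(a, c)] is
     common to all [U ^+ j] with a nonzero coefficient in [p]. *)
  pose q := \poly_(j < d.+1) (p`_j * (U ^+ j) a c).
  have q0 : horner_mx U q = 0.
    rewrite horner_sum ?size_poly //; apply/matrixP=> b e; rewrite summxE mxE.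
    have := congr1 (fun M : 'M_n.+1 => M c e) (sum0 (delta_mx a b)).
    rewrite summxE mxE => h; rewrite -[RHS]h; apply: eq_bigr => j _.
    rewrite !mxE coef_poly ltn_ord -mulrA; congr (_ * _).
    rewrite (bigD1 b) //= big1 ?addr0 => [|l lb].
      rewrite mxE (bigD1 a) //= big1 ?addr0 => [|l la].
        by rewrite !mxE !eqxx mulr1.
      by rewrite !mxE (negPf la) mulr0.
    by rewrite mxE big1 ?mul0r // => m _; rewrite !mxE (negPf lb) andbF mulr0.
  have /dvdpP[w def_q] := mxminpoly_min q0.
  have w1 : (size w <= 1)%N.
    have [->|w0] := eqVneq w 0; first by rewrite size_poly0.
    have : (size (w * p)%R <= d.+1)%N by rewrite -def_q size_poly.
    have -> : size (w * p)%R = (size w + d.+1).-1.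
      by rewrite -size_p; apply: size_mul w0 (monic_neq0 (mxminpoly_monic U)).
    rewrite -subn1.
    by rewrite leq_subLR leq_add2r.
  have coef_q j : (j < d.+1)%N -> p`_j * (U ^+ j) a c = w`_0 * p`_j.
    move=> jd; have := congr1 (fun r : {poly k} => r`_j) def_q.
    by rewrite [in RHS](size1_polyC w1) coefCM coef_poly jd.
  apply: (mulfI pi0); rewrite coef_q // -[w`_0]mulr1 -p_d -coef_q // p_d mul1r.
  by rewrite mulrC.
have [i lt_id pi0] : exists2 i, (i < d)%N & p`_i != 0.
  have [/existsP[i pi0]|/existsPn p0] := boolP [exists i : 'I_d, p`_i != 0].
    by exists i.
  have := mx_root_minpoly U; rewrite horner_sum ?size_p // big_ord_recr /= big1.
    by rewrite add0r -/p p_d scale1r => /eqP; rewrite (negPf (U0 _)).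
  by move=> i _; have := p0 i; rewrite negbK => /eqP->; rewrite scale0r.
have UN : U ^+ (d - i) = 1.
  have : U ^+ i * U ^+ (d - i) = U ^+ i by rewrite -exprD subnKC ?eq_pow // ltnW.
  by rewrite -[X in _ = X]mulr1 => /mulrI-> //; apply: unitrX.
exists (d - i)%N; split; rewrite ?subn_gt0 // => z zN.
rewrite eigenvalue_root_min.
have dvd_p : p %| 'X^(d - i) - 1.
  by apply: mxminpoly_min; rewrite rmorphB rmorphXn /= horner_mx_X rmorph1 UN subrr.
have XN0 : 'X^(d - i) - 1 != 0 :> {poly k} by rewrite monic_neq0 ?monicXnsubC ?subn_gt0.
(* [p] has degree [d] and divides a nonzero polynomial of degree [d - i], so the two are
   associate. *)
have : p %= 'X^(d - i) - 1.
  rewrite -dvdp_size_eqp // eqn_leq dvdp_leq //= size_p size_XnsubC ?subn_gt0 //.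
  by rewrite ltnS leq_subr.
by move/eqp_root->; rewrite /root !hornerE zN subrr.
Qed.

(* The multiplicity function of the eigenvalues of [U] is its own convolution
   square up to the factor [n]; looking at its maximum, it must be constant. *)
Lemma grouplike_operator_trace n (U : 'M[k]_n) (Phi : {linear 'M[k]_n -> 'M[k]_n}) :
    (0 < n)%N -> U \in unitmx -> injective Phi ->
    (forall X, Phi (U^T *m X) = U^T *m Phi X *m U) ->
  exists N, [/\ (0 < N)%N, (N %| n)%N, U ^+ N = 1 &
                forall i, ~~ (N %| i)%N -> \tr (U ^+ i) = 0].
Proof.
move=> n0 unitU injPhi PhiU.
have [N [N0 UN eigU]] := grouplike_operator_order n0 unitU injPhi PhiU.
have trU2 i : \tr (U ^+ i) ^+ 2 = n%:R * \tr (U ^+ i).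
  have := mxtrace_mul_intertwine injPhi (fun X => intertwine_exp i X PhiU).
  by rewrite mxtrace_tr expr2 => <-.
have [|||X uX dX] := @finite_order_codiagonalizable _ char0 n N [:: U] => //.
- by move=> A; rewrite inE => /eqP->.
- by move=> A B; rewrite !inE => /eqP-> /eqP->.
have [u dU] := dX U (mem_head _ _).
have u_N l : u l ^+ N = 1.
  by apply: (diag_in_inj uX (diag_in_exp N dU)); rewrite UN; apply: diag_in1.
have trU i : \tr (U ^+ i) = \sum_l u l ^+ i.
  by rewrite (diag_in_trace uX (diag_in_exp i dU)).
have unity_n0 z : z ^+ N = 1 -> z != 0 :> k.
  move=> zN; apply: contra_eqN zN => /eqP->.
  by rewrite expr0n (gtn_eqF N0) eq_sym oner_eq0.
have u0 l : u l != 0 by apply: unity_n0.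
have u_onto z : z ^+ N = 1 -> exists l, u l = z.
  move=> /eigU/eigenvalueP[v vU v0].
  have vX0 : v *m invmx X != 0.
    by apply: contra v0 => /eqP vX; rewrite -(mulmxKV uX v) vX mul0mx.
  have [l vXl] : exists l, (v *m invmx X) 0 l != 0.
    by apply/rV0Pn.
  exists l; apply: (mulfI vXl).
  have : v *m invmx X *m diag_mx (\row_l u l) = z *: (v *m invmx X).
    rewrite -mulmxA (_ : invmx X *m _ = U *m invmx X).
      by rewrite mulmxA vU scalemxAl.
    by rewrite (diag_in_conj uX dU) mulmxK.
  move/rowP/(_ l); rewrite mul_mx_diag !mxE => ->; exact: mulrC.
pose m z := #|[pred l | u l == z]|.
have mul_conv z : z ^+ N = 1 -> (\sum_l m (z / u l)%R = n * m z)%N.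
  move=> zN.
  (* The relation [trU2] becomes a single vanishing power sum over a disjoint union: pairs carry
     products of two eigenvalues with weight 1, single indices carry one eigenvalue with weight
     [- n%:R]. *)
  pose f (x : 'I_n * 'I_n + 'I_n) : k := if x is inr _ then - n%:R else 1.
  pose v x := match x with inl ll => u ll.1 * u ll.2 | inr l => u l end.
  have vN x : v x ^+ N = 1 by case: x => [ll|l] /=; rewrite ?exprMn !u_N ?mulr1.
  have fv i : \sum_x f x * v x ^+ i = 0.
    rewrite big_sumType /= -[X in _ + X]mulr_sumr -trU mulNr -trU2 trU expr2.
    apply/eqP; rewrite subr_eq0; apply/eqP; rewrite big_distrlr pair_bigA /=.
    by apply: eq_bigr => ll _; rewrite mul1r exprMn.
  have := fourier_separate char0 N0 vN zN fv.
  rewrite big_sumType /= !sumr_const -/(m z) => /eqP.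
  rewrite mulNrn subr_eq0 -mulrnA => /eqP/(natr_inj_char0 char0) <-.
  transitivity (\sum_l \sum_(l' | (u l * u l' == z)%R) 1)%N; last first.
    by rewrite pair_big_dep -sum1_card.
  apply: eq_bigr => l _; rewrite /m -sum1_card; apply: eq_bigl => l'.
  by rewrite !inE -(inj_eq (mulfI (u0 l))) mulrCA mulfV // mulr1.
have [w prim_w] := prim_root_exists char0 N0.
have wN j : (w ^+ j) ^+ N = 1 by rewrite exprAC (prim_expr_order prim_w) expr1n.
pose j0 := [arg max_(j > Ordinal N0) m (w ^+ j)].
have m_max z : z ^+ N = 1 -> (m z <= m (w ^+ j0))%N.
  move=> /(prim_rootP prim_w)[j ->]; rewrite /j0; case: arg_maxnP => // i _.
  exact.
(* At the maximum, [mul_conv] averages [n] multiplicities, none larger than that maximum, so all are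
   equal to it. By [u_onto] every [z] arises as a quotient [w ^+ j0 / u l]. *)
have m_const z : z ^+ N = 1 -> m z = m (w ^+ j0).
  move=> zN; have [|l ul] := u_onto (w ^+ j0 / z).
    by rewrite exprMn exprVn zN wN invr1 mulr1.
  have le_l l' : (m (w ^+ j0 / u l')%R <= m (w ^+ j0))%N.
    by apply: m_max; rewrite exprMn exprVn u_N wN invr1 mulr1.
  have := leqif_sum (fun l' (_ : true) => leqif_eq (le_l l')).
  rewrite mul_conv // sum_nat_const card_ord => -[_].
  rewrite eqxx => /esym/forallP/(_ l)/=/eqP <-.
  by rewrite ul invf_div mulrCA mulfV ?mulr1 // unity_n0.
have sum_u (R : nmodType) (F : k -> R) :
    \sum_l F (u l) = (\sum_(j < N) F (w ^+ j)) *+ m (w ^+ j0).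
  rewrite (partition_big (fun l => sval (prim_rootP prim_w (u_N l))) predT) //=.
  rewrite -sumrMnl; apply: eq_bigr => j _.
  rewrite -(m_const _ (wN j)) -sumr_const.
  apply: eq_big => l; case: prim_rootP => j' /= ul.
    by rewrite inE ul (eq_prim_root_expr prim_w) !modn_small.
  by rewrite ul => /eqP->.
exists N; split=> [||//|i Ni]; first exact: N0.
  apply/dvdnP; exists (m (w ^+ j0)); rewrite mulnC.
  have := sum_u k (fun=> 1); rewrite !sumr_const !card_ord -mulrnA.
  exact: natr_inj_char0.
rewrite trU (sum_u _ (fun z => z ^+ i)).
under eq_bigr do rewrite exprAC.
rewrite (sum_expr_unity (wN i)).
by rewrite -(prim_order_dvd prim_w) (negPf Ni) mul0rn.
Qed.
End Operators.

(** * Sweedler calculus *)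

(** A name for linearity of bare functions, on which the tactics below match to prove multilinearity
    from the syntax of a term. *)
Definition lin (K : fieldType) (U V : lmodType K) (f : U -> V) : Prop := linear f.

Section LinearMaps.
Variable K : fieldType.
Implicit Types U V W : vectType K.

Definition mklin U V (f : U -> V) (fP : lin f) : {linear U -> V} :=
  HB.pack f (GRing.isLinear.Build K U V *:%R f fP).

Definition mkhom U V (f : U -> V) (fP : lin f) : 'Hom(U, V) := linfun (mklin fP).

Lemma mkhomE U V (f : U -> V) (fP : lin f) x : mkhom fP x = f x.
Proof. exact: (lfunE (mklin fP)). Qed.

Lemma lin_id U : lin (fun x : U => x). Proof. by []. Qed.

Lemma lin_comp U V W (g : V -> W) (f : U -> V) :
  lin g -> lin f -> lin (fun x => g (f x)).
Proof. by move=> lg lf a x y; rewrite lf lg. Qed.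

Lemma lin_fun U V W (g : {linear V -> W}) (f : U -> V) :
  lin f -> lin (fun x => g (f x)).
Proof. by move=> lf a x y; rewrite lf linearP. Qed.

Lemma lin_lfun U V W (g : 'Hom(V, W)) (f : U -> V) :
  lin f -> lin (fun x => g (f x)).
Proof. exact: lin_fun. Qed.

Lemma lin_mull U (A : falgType K) (c : A) (f : U -> A) :
  lin f -> lin (fun x => c * f x).
Proof. by move=> lf a x y; rewrite lf mulrDr scalerAr. Qed.

Lemma lin_mulr U (A : falgType K) (c : A) (f : U -> A) :
  lin f -> lin (fun x => f x * c).
Proof. by move=> lf a x y; rewrite lf mulrDl scalerAl. Qed.

Lemma lin_scalel U V (f : U -> K^o) (v : V) :
  lin f -> lin (fun x => (f x : K) *: v).
Proof. by move=> lf a x y; rewrite lf scalerDl scalerA. Qed.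

Lemma lin_scaler U V (f : U -> V) (c : K) :
  lin f -> lin (fun x => c *: f x).
Proof. by move=> lf a x y; rewrite lf scalerDr !scalerA mulrC. Qed.

Lemma lin_sum U V (I : finType) (f : I -> U -> V) :
  (forall i, lin (f i)) -> lin (fun x => \sum_i f i x).
Proof.
move=> lf a x y; rewrite scaler_sumr -big_split; apply: eq_bigr => i _.
exact: lf.
Qed.

Lemma lin_otl U V W (f : U -> V) (w : W) : lin f -> lin (fun x => f x \ot w).
Proof. by move=> lf a x y; rewrite lf (tens_pure_bilinear V W).1. Qed.

Lemma lin_otr U V W (f : U -> V) (w : W) : lin f -> lin (fun x => w \ot f x).
Proof. by move=> lf a x y; rewrite lf (tens_pure_bilinear W V).2. Qed.

Lemma lin_tens_lift U V V' W (F : V -> V' -> W) (f : U -> tensv V V') :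
  lin f -> lin (fun x => tens_lift F (f x)).
Proof. exact: lin_fun. Qed.

Lemma lin_tens_liftf U V V' W (F : U -> V -> V' -> W) (t : tensv V V') :
  (forall a b, lin (fun x => F x a b)) -> lin (fun x => tens_lift (F x) t).
Proof.
move=> lF a x y; rewrite /tens_lift scaler_sumr -big_split; apply: eq_bigr => i _.
rewrite scaler_sumr -big_split; apply: eq_bigr => j _ /=.
by rewrite lF scalerDr !scalerA mulrC.
Qed.

Lemma tens_lift_map V V' W W' (g : W -> W') (F : V -> V' -> W) t :
  lin g -> g (tens_lift F t) = tens_lift (fun a b => g (F a b)) t.
Proof.
move=> lg; pose L := mklin lg; rewrite -[g _]/(L _) linear_sum.
apply: eq_bigr => i _; rewrite linear_sum; apply: eq_bigr => j _.
by rewrite linearZ.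
Qed.

Lemma eq_tens_lift V V' W (F G : V -> V' -> W) t :
  (forall a b, F a b = G a b) -> tens_lift F t = tens_lift G t.
Proof.
by move=> FG; apply: eq_bigr => i _; apply: eq_bigr => j _; rewrite FG.
Qed.

Lemma tens_lift_ot V V' W (F : V -> V' -> W) u v :
  (forall b, lin (F^~ b)) -> (forall a, lin (F a)) -> tens_lift F (u \ot v) = F u v.
Proof. by move=> Fl Fr; apply: tens_lift_pure; split. Qed.

Lemma tens_lift_exchange U U' V V' W (F : U -> U' -> V -> V' -> W) s t :
  tens_lift (fun a b => tens_lift (F a b) t) s =
  tens_lift (fun c d => tens_lift (fun a b => F a b c d) s) t.
Proof.
rewrite /tens_lift; under eq_bigr => i _ do under eq_bigr => j _ do rewrite scaler_sumr.
under eq_bigr => i _ do rewrite exchange_big.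
rewrite exchange_big; apply: eq_bigr => l _ /=.
under eq_bigr => i _ do under eq_bigr => j _ do rewrite scaler_sumr.
under eq_bigr => i _ do rewrite exchange_big.
rewrite exchange_big; apply: eq_bigr => m _ /=.
rewrite scaler_sumr; apply: eq_bigr => i _; rewrite scaler_sumr.
by apply: eq_bigr => j _; rewrite !scalerA mulrC.
Qed.

End LinearMaps.

Ltac lin_step :=
  match goal with
  | |- lin (fun x => x) => apply lin_id
  | |- lin (GRing.mul ?c) => change (lin (fun x => c * x))
  | |- lin (GRing.scale ?c) => change (lin (fun x => c *: x))
  | |- lin (tens_lift ?F) => change (lin (fun t => tens_lift F t))
  | |- lin (tens_pure ?u) => change (lin (fun v => u \ot v))
  | |- lin (fun_of_lfun ?g) => change (lin (fun v => fun_of_lfun g v))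
  | |- lin (fun x => ?c * @?f x) => apply (@lin_mull _ _ _ c f)
  | |- lin (fun x => @?f x * ?c) => apply (@lin_mulr _ _ _ c f)
  | |- lin (fun x => @?f x \ot ?c) => apply (@lin_otl _ _ _ _ f c)
  | |- lin (fun x => ?c \ot @?f x) => apply (@lin_otr _ _ _ _ f c)
  | |- lin (fun x => ?c *: @?f x) => apply (@lin_scaler _ _ _ f c)
  | |- lin (fun x => @?f x *: ?v) => apply (@lin_scalel _ _ _ f v)
  | |- lin (fun x => tens_lift ?F (@?f x)) => apply (@lin_tens_lift _ _ _ _ _ F f)
  | |- lin (fun x => tens_lift (@?F x) ?t) =>
      apply (@lin_tens_liftf _ _ _ _ _ F t); let a := fresh in let b := fresh in
      intros a b
  | |- lin (fun x => \sum_(i : _) @?F i x) =>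
      apply (@lin_sum _ _ _ _ (fun i x => F i x)); intros ?
  | |- lin (fun x => fun_of_lfun ?g (@?f x)) => apply (@lin_lfun _ _ _ _ g f)
  | _ => first [assumption | match goal with h : _ |- _ => apply h end]
  end.
Ltac lin := intros; cbv beta; repeat (lin_step; cbv beta).

Section Sweedler.
Variables (K : fieldType) (H : falgType K) (hopf : hopf_algebra H).
Implicit Types U V W : vectType K.
Local Notation Delta := (comul hopf).
Local Notation eps := (counit hopf).
Local Notation S := (antipode hopf).

(* [sweedler F x] is the sum of the [F x_(1) x_(2)]. *)
Definition sweedler W (F : H -> H -> W) (x : H) : W := tens_lift F (Delta x).
Local Notation sw := sweedler.

Lemma lin_sw U W (F : H -> H -> W) (f : U -> H) :
  lin f -> lin (fun x => sw F (f x)).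
Proof. by move=> lf; rewrite /sweedler; lin. Qed.

Lemma lin_swf U W (F : U -> H -> H -> W) t :
  (forall a b, lin (fun x => F x a b)) -> lin (fun x => sw (F x) t).
Proof. by move=> lF; rewrite /sweedler; lin. Qed.

Lemma eq_sw W (F G : H -> H -> W) x : (forall a b, F a b = G a b) -> sw F x = sw G x.
Proof. exact: eq_tens_lift. Qed.

Lemma sw_map W W' (g : W -> W') (F : H -> H -> W) x : lin g ->
  g (sw F x) = sw (fun a b => g (F a b)) x.
Proof. exact: tens_lift_map. Qed.

Lemma sw_exchange W (F : H -> H -> H -> H -> W) x y :
  sw (fun a b => sw (F a b) y) x = sw (fun c d => sw (fun a b => F a b c d) x) y.
Proof. exact: tens_lift_exchange. Qed.

(** Both sides are images of the iterated coproduct under the linear map [G] that the trilinear [F]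
    induces on the triple tensor product. *)
Lemma sw_assoc W (F : H -> H -> H -> W) x :
    (forall b c, lin (fun a => F a b c)) -> (forall a c, lin (fun b => F a b c)) ->
    (forall a b, lin (F a b)) ->
  sw (fun u c => sw (fun a b => F a b c) u) x = sw (fun a v => sw (F a) v) x.
Proof.
move=> F1 F2 F3.
pose G t := tens_lift (fun a t' => tens_lift (F a) t') t.
have lG : lin G by rewrite /G; lin.
have GE a s : G (a \ot s) = tens_lift (F a) s.
  by rewrite /G tens_lift_ot; lin.
transitivity (G (tens_assoc (tens_map Delta id (Delta x)))).
  have lA : lin (fun t => G (tens_assoc t)) by apply: lin_comp => //; apply: lin_fun.
  rewrite /tens_map (tens_lift_map (g := fun t => G (tens_assoc t))) //.
  apply: eq_sw => u c; rewrite /tens_assoc tens_lift_ot; try by lin.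
  rewrite (tens_lift_map _ _ lG); apply: eq_tens_lift => a b.
  by rewrite GE tens_lift_ot; lin.
rewrite (comulA hopf) /tens_map (tens_lift_map _ _ lG).
by apply: eq_sw => a v; rewrite GE.
Qed.

Lemma sw_counitl W (F : H -> W) x : lin F -> sw (fun a b => (eps a : K) *: F b) x = F x.
Proof.
move=> lF; rewrite -[in RHS](proj1 (comul_counit hopf) x) (tens_lift_map _ _ lF).
by apply: eq_tens_lift => a b; rewrite -[RHS]/(mklin lF _) linearZ.
Qed.

Lemma sw_counitr W (F : H -> W) x : lin F -> sw (fun a b => (eps b : K) *: F a) x = F x.
Proof.
move=> lF; rewrite -[in RHS](proj2 (comul_counit hopf) x) (tens_lift_map _ _ lF).
by apply: eq_tens_lift => a b; rewrite -[RHS]/(mklin lF _) linearZ.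
Qed.

Lemma sw1 W (F : H -> H -> W) :
  (forall b, lin (F^~ b)) -> (forall a, lin (F a)) -> sw F 1 = F 1 1.
Proof. by move=> F1 F2; rewrite /sweedler comul1 tens_lift_ot. Qed.

Lemma swM W (F : H -> H -> W) x y :
    (forall b, lin (F^~ b)) -> (forall a, lin (F a)) ->
  sw F (x * y) = sw (fun a b => sw (fun c d => F (a * c) (b * d)) y) x.
Proof.
move=> F1 F2; rewrite /sweedler comulM /tens_mul tens_lift_map; last exact: lin_tens_lift.
apply: eq_tens_lift => a b; rewrite tens_lift_map; last exact: lin_tens_lift.
by apply: eq_tens_lift => c d; rewrite tens_lift_ot.
Qed.

Lemma sw_Sl W (F : H -> W) x : lin F ->
  sw (fun a b => F (S a * b)) x = (eps x : K) *: F 1.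
Proof.
move=> lF; rewrite -(sw_map _ _ lF) /sw (antipodeL hopf).
by rewrite -[LHS]/(mklin lF _) linearZ.
Qed.

Lemma sw_Sr W (F : H -> W) x : lin F ->
  sw (fun a b => F (a * S b)) x = (eps x : K) *: F 1.
Proof.
move=> lF; rewrite -(sw_map _ _ lF) /sw (antipodeR hopf).
by rewrite -[LHS]/(mklin lF _) linearZ.
Qed.

(** This and the three variants below cancel an antipode against its neighbour in a threefold
    coproduct; read backwards, they insert such a pair. *)
Lemma sw_Sl_head W (F : H -> H -> W) x :
    (forall b, lin (F^~ b)) -> (forall a, lin (F a)) ->
  sw (fun a u => sw (fun b c => F (S a * b) c) u) x = F 1 x.
Proof.
move=> F1 F2; rewrite -(sw_assoc (F := fun a b c => F (S a * b) c)).
- by under eq_sw => u c do rewrite (sw_Sl (F := F^~ c)) //; rewrite sw_counitl.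
- move=> b c; apply: (lin_comp (g := F^~ c)); [exact: F1 | by lin].
- move=> b c; apply: (lin_comp (g := F^~ c)); [exact: F1 | by lin].
- by move=> a b; apply: F2.
Qed.

Lemma sw_Sr_head W (F : H -> H -> W) x :
    (forall b, lin (F^~ b)) -> (forall a, lin (F a)) ->
  sw (fun a u => sw (fun b c => F (a * S b) c) u) x = F 1 x.
Proof.
move=> F1 F2; rewrite -(sw_assoc (F := fun a b c => F (a * S b) c)).
- by under eq_sw => u c do rewrite (sw_Sr (F := F^~ c)) //; rewrite sw_counitl.
- move=> b c; apply: (lin_comp (g := F^~ c)); [exact: F1 | by lin].
- move=> b c; apply: (lin_comp (g := F^~ c)); [exact: F1 | by lin].
- by move=> a b; apply: F2.
Qed.

Lemma sw_Sl_tail W (F : H -> H -> W) x :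
    (forall b, lin (F^~ b)) -> (forall a, lin (F a)) ->
  sw (fun a u => sw (fun b c => F a (S b * c)) u) x = F x 1.
Proof.
move=> F1 F2; under eq_sw => a u do rewrite (sw_Sl (F := F a)) //.
by rewrite (sw_counitr (F := F^~ 1)).
Qed.

Lemma sw_Sr_tail W (F : H -> H -> W) x :
    (forall b, lin (F^~ b)) -> (forall a, lin (F a)) ->
  sw (fun a u => sw (fun b c => F a (b * S c)) u) x = F x 1.
Proof.
move=> F1 F2; under eq_sw => a u do rewrite (sw_Sr (F := F a)) //.
by rewrite (sw_counitr (F := F^~ 1)).
Qed.

End Sweedler.

Ltac lin_sw_step :=
  match goal with
  | |- lin (sweedler ?h ?F) => change (lin (fun x => sweedler h F x))
  | |- lin (fun x => sweedler ?h ?F (@?f x)) => apply (@lin_sw _ _ h _ _ F f)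
  | |- lin (fun x => sweedler ?h (@?F x) ?t) =>
      apply (@lin_swf _ _ h _ _ F t); let a := fresh in let b := fresh in
      intros a b
  | _ => lin_step
  end.
Ltac slin := intros; cbv beta; repeat (lin_sw_step; cbv beta).

Ltac sl := try solve [slin].

(** * The antipode reverses products and coproducts *)

Section Antipode.
Variables (K : fieldType) (H : falgType K) (hopf : hopf_algebra H).
Implicit Types U V W : vectType K.
Local Notation Delta := (comul hopf).
Local Notation eps := (counit hopf).
Local Notation S := (antipode hopf).
Local Notation sw := (sweedler hopf).

Lemma antipode1 : S 1 = 1.
Proof.
have := sw_Sl hopf (F := fun x => x) 1 (@lin_id _ _).
by rewrite sw1 ?counit1 ?scale1r ?mulr1 //; slin.
Qed.

(** Both sides are convolution inverses of the multiplication. The expression [Y] contracts from the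
    right to [S (x * y)] and, after regrouping, from the left to [S y * S x]. *)
Lemma antipodeM x y : S (x * y) = S y * S x.
Proof.
pose Y := sw (fun a b => sw (fun a2 a3 => sw (fun c d => sw (fun c2 c3 =>
  S (a * c) * (a2 * (c2 * S c3) * S a3)) d) y) b) x.
transitivity Y.
  rewrite /Y; under eq_sw => a b do under eq_sw => a2 a3 do
    [rewrite (sw_Sr_tail hopf (F := fun c z => S (a * c) * (a2 * z * S a3)));
      sl; rewrite mulr1].
  by rewrite (sw_Sr_tail hopf (F := fun a z => S (a * y) * z)) ?mulr1; slin.
rewrite /Y -(sw_assoc hopf (F := fun a a2 a3 => sw (fun c d => sw (fun c2 c3 =>
  S (a * c) * (a2 * (c2 * S c3) * S a3)) d) y)); sl.
transitivity (sw (fun u a3 => sw (fun v c3 =>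
    (eps u : K) *: ((eps v : K) *: (S c3 * S a3))) y) x); last first.
  under eq_sw => u a3 do [rewrite -(sw_map hopf (g := fun z => (eps u : K) *: z));
    sl; rewrite (sw_counitl hopf (F := fun z => S z * S a3)); sl].
  by rewrite (sw_counitl hopf (F := fun z => S y * S z)); slin.
apply: eq_sw => u a3.
transitivity (sw (fun a a2 => sw (fun v c3 => sw (fun c c2 =>
   S (a * c) * (a2 * c2) * (S c3 * S a3)) v) y) u).
  apply: eq_sw => a a2; rewrite -(sw_assoc hopf (F := fun c c2 c3 =>
    S (a * c) * (a2 * (c2 * S c3) * S a3))); sl.
  by apply: eq_sw => v c3; apply: eq_sw => c c2; rewrite !mulrA.
rewrite sw_exchange; apply: eq_sw => v c3.
rewrite -(swM hopf (F := fun p q => S p * q * (S c3 * S a3))); sl.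
rewrite (sw_Sl hopf (F := fun z => z * (S c3 * S a3))); last by slin.
by rewrite mul1r counitM scalerA.
Qed.

(* Both sides are convolution inverses of the comultiplication. *)
Lemma swS W (F : H -> H -> W) x :
    (forall b, lin (F^~ b)) -> (forall a, lin (F a)) ->
  sw F (S x) = sw (fun a b => F (S b) (S a)) x.
Proof.
move=> F1 F2.
have lF2 U (g : U -> H) c : lin g -> lin (fun x => F c (g x)).
  by move=> lg; apply: lin_comp.
have lF1 U (g : U -> H) c : lin g -> lin (fun x => F (g x) c).
  by move=> lg; apply: (lin_comp (g := F^~ c)).
(* Three factors are multiplied: the coproduct of [S x_(1)], then [x_(2) (x) x_(3)], then
   [S x_(5) (x) S x_(4)]. Cancelling the last two leaves the left side, cancelling the first two
   leaves the right side. *)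
pose X := sw (fun a b => sw (fun c d => sw (fun e t => sw (fun u v =>
  sw (fun s1 s2 => F (s1 * (c * S v)) (s2 * (e * S u))) (S a)) t) d) b) x.
transitivity X.
  apply/esym; rewrite /X; under eq_sw => a b do under eq_sw => c d do
    [rewrite (sw_Sr_head hopf (F := fun z v =>
      sw (fun s1 s2 => F (s1 * (c * S v)) (s2 * z)) (S a))); sl].
  under eq_sw => a b do
    [rewrite (sw_Sr hopf (F := fun z =>
      sw (fun s1 s2 => F (s1 * z) (s2 * 1)) (S a))); sl].
  rewrite (sw_counitr hopf (F := fun a => sw (fun s1 s2 => F (s1 * 1) (s2 * 1)) (S a))).
    by apply: eq_sw => a b; rewrite !mulr1.
  by slin.
transitivity (sw (fun a b => sw (fun w t => sw (fun u v =>
    sw (fun p q => F (p * S v) (q * S u)) (S a * w)) t) b) x).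
  apply: eq_sw => a b; rewrite -(sw_assoc hopf (F := fun c e t => sw (fun u v =>
    sw (fun s1 s2 => F (s1 * (c * S v)) (s2 * (e * S u))) (S a)) t)); sl.
  apply: eq_sw => w t; rewrite sw_exchange; apply: eq_sw => u v.
  rewrite swM; sl; rewrite sw_exchange; apply: eq_sw => s1 s2; apply: eq_sw => c e.
  by rewrite !mulrA.
rewrite (sw_Sl_head hopf (F := fun z t => sw (fun u v =>
    sw (fun p q => F (p * S v) (q * S u)) z) t)); sl.
apply: eq_sw => u v; rewrite (sw1 hopf (F := fun p q => F (p * S v) (q * S u))); sl.
by rewrite !mul1r.
Qed.

Lemma swSS W (F : H -> H -> W) x :
    (forall b, lin (F^~ b)) -> (forall a, lin (F a)) ->
  sw F (S (S x)) = sw (fun a b => F (S (S a)) (S (S b))) x.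
Proof.
move=> F1 F2.
have lF2 U (g : U -> H) c : lin g -> lin (fun x => F c (g x)).
  by move=> lg; apply: lin_comp.
have lF1 U (g : U -> H) c : lin g -> lin (fun x => F (g x) c).
  by move=> lg; apply: (lin_comp (g := F^~ c)).
by rewrite swS // (swS (F := fun a b => F (S b) (S a))); slin.
Qed.

End Antipode.

(** * Integrals and traces *)

Lemma linZ (K : fieldType) (U V : lmodType K) (f : U -> V) a u :
  lin f -> f (a *: u) = a *: f u.
Proof.
move=> lf; have f0 : f 0 = 0.
  by apply: (addrI (f 0)); rewrite addr0 -{2}(scale1r (f 0)) addrC -lf scale1r addr0.
by rewrite -[a *: u]addr0 lf f0 addr0.
Qed.

Section Trace.
Variables (K : fieldType) (V : vectType K).
Implicit Types f g : 'End(V).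
Local Notation e := (vbasis {:V}).

Lemma lfun_traceE f : lfun_trace f = \sum_i coord e i (f e`_i).
Proof.
by apply: eq_bigr => i _; rewrite !mxE /= passmx.vecof_delta.
Qed.

Lemma lfun_trace_lin : lin (fun f : 'End(V) => lfun_trace f : K^o).
Proof. by move=> a f g; rewrite /lfun_trace passmx.mxof_linear linearP. Qed.

Lemma lfun_traceC f g : lfun_trace (f \o g)%VF = lfun_trace (g \o f)%VF.
Proof.
have ve := vbasisP {:V}.
by rewrite /lfun_trace !(passmx.mxof_comp _ _ ve) mxtrace_mulC.
Qed.

Lemma lfun_trace1 : lfun_trace (\1%VF : 'End(V)) = (\dim {:V})%:R.
Proof.
by rewrite /lfun_trace passmx.mxof1 ?mxtrace1 // (basis_free (vbasisP _)).
Qed.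

Lemma coord_lin (W : vectType K) i : lin (fun w : W => coord (vbasis {:W}) i w : K^o).
Proof. by move=> a f g; rewrite linearP. Qed.

Definition dual_basis (W : vectType K) (i : 'I_(\dim {:W})) : 'Hom(W, K^o) :=
  mkhom (@coord_lin W i).

Lemma dual_basisE (W : vectType K) i (w : W) :
  dual_basis i w = coord (vbasis {:W}) i w.
Proof. exact: mkhomE. Qed.

Lemma hom_separate (W : vectType K) (u v : W) :
  (forall f : 'Hom(W, K^o), f u = f v) -> u = v.
Proof.
move=> uv; rewrite (coord_vbasis (memvf u)) (coord_vbasis (memvf v)).
apply: eq_bigr => i _; congr (_ *: _).
by have := uv (dual_basis i); rewrite !dual_basisE.
Qed.

End Trace.

Section Operators.
Variables (K : fieldType) (H : falgType K) (hopf : hopf_algebra H).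
Implicit Types U V W : vectType K.
Implicit Types (f g : 'Hom(H, K^o)) (x y h : H).
Local Notation eps := (counit hopf).
Local Notation S := (antipode hopf).
Local Notation sw := (sweedler hopf).
Local Notation tr := lfun_trace.
Local Notation T := (S \o S)%VF.

Lemma amullE x y : amull x y = x * y. Proof. by rewrite lfunE. Qed.
Lemma amulrE x y : amulr x y = y * x. Proof. by rewrite lfunE. Qed.

Lemma hit_lin f : lin (fun h => sw (fun a b => (f b : K) *: a) h).
Proof. by slin. Qed.
Lemma hitby_lin f : lin (fun h => sw (fun a b => (f a : K) *: b) h).
Proof. by slin. Qed.

(* [hit f h] is [f -> h], the sum of the [f h_(2) *: h_(1)], and [hitby f h] is
   [h <- f], the sum of the [f h_(1) *: h_(2)]. *)
Definition hit f : 'End(H) := mkhom (@hit_lin f).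
Definition hitby f : 'End(H) := mkhom (@hitby_lin f).

Lemma hitE f h : hit f h = sw (fun a b => (f b : K) *: a) h.
Proof. exact: mkhomE. Qed.
Lemma hitbyE f h : hitby f h = sw (fun a b => (f a : K) *: b) h.
Proof. exact: mkhomE. Qed.

Definition left_integral (L : H) := forall h, h * L = (eps h : K) *: L.

Lemma sw_lfun W (F : H -> H -> 'End(W)) x w : (sw F x) w = sw (fun a b => F a b w) x.
Proof.
apply: (sw_map hopf (g := fun f : 'End(W) => f w)) => a f g.
by rewrite !lfunE /= lfunE.
Qed.

Lemma trace_sw (F : H -> H -> 'End(H)) x :
  tr (sw F x) = sw (fun a b => tr (F a b) : K^o) x.
Proof. exact: (sw_map hopf _ x (@lfun_trace_lin K H)). Qed.

(* If X is the operator traced for [f], the one for [f (h _)] is the sum of the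
   L_{S h_(2)} o X o L_{h_(1)}, and the trace is cyclic. *)
Lemma trace_left_integral x :
  exists2 L, left_integral L & forall f, f L = tr (amulr x \o T \o hitby f)%VF.
Proof.
pose e := vbasis {:H}.
(* Expanding the trace in the basis [e] exhibits it, as a functional of [f], as evaluation at this
   element. *)
pose L := \sum_i sw (fun a b => (coord e i (S (S b) * x) : K) *: a) e`_i.
have LE f : f L = tr (amulr x \o T \o hitby f)%VF.
  rewrite lfun_traceE linear_sum; apply: eq_bigr => i _ /=.
  rewrite (sw_map hopf (g := fun z => f z)); last by slin.
  rewrite !comp_lfunE amulrE hitbyE.
  rewrite (sw_map hopf (g := fun z => coord e i (S (S z) * x) : K^o)); last first.
    by apply: (lin_comp (coord_lin i)); slin.
  apply: eq_sw => a b; rewrite !linearZ /= -scalerAl linearZ /=.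
  exact: mulrC.
exists L => // h; apply: hom_separate => f.
rewrite -amullE -comp_lfunE LE linearZ /= LE.
pose X := (amulr x \o T \o hitby f)%VF.
have -> : (amulr x \o T \o hitby (f \o amull h))%VF =
    sw (fun a b => (amull (S b) \o X \o amull a)%VF) h.
  apply/lfunP=> y; rewrite sw_lfun.
  transitivity (sw (fun a b => S b * sw (fun p q => sw (fun y1 y2 =>
      (f (p * y1) : K) *: (S (S (q * y2)) * x)) y) a) h); last first.
    apply: eq_sw => a b; rewrite !comp_lfunE !amullE amulrE hitbyE; congr (_ * _).
    rewrite (sw_map hopf (g := fun z => S (S z) * x)); last by slin.
    rewrite swM; sl; apply: eq_sw => p q; apply: eq_sw => y1 y2.
    by rewrite !linearZ /= scalerAl.
  rewrite !comp_lfunE amulrE hitbyE.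
  rewrite (sw_map hopf (g := fun z => S (S z) * x)); last by slin.
  transitivity (sw (fun a b => sw (fun p q => sw (fun y1 y2 =>
      (f (p * y1) : K) *: (S (S q * b) * (S (S y2) * x))) y) a) h); last first.
    apply: eq_sw => a b; rewrite (sw_map hopf (g := fun z => S b * z)); last by slin.
    apply: eq_sw => p q; rewrite (sw_map hopf (g := fun z => S b * z)); last by slin.
    apply: eq_sw => y1 y2; rewrite -scalerAr !mulrA; congr (_ *: (_ * _)).
    by rewrite (antipodeM hopf (S q)) (antipodeM hopf q) (antipodeM hopf (S y2)) !mulrA.
  rewrite (sw_assoc hopf (F := fun p q b => sw (fun y1 y2 =>
      (f (p * y1) : K) *: (S (S q * b) * (S (S y2) * x))) y)); sl.
  rewrite (sw_Sl_tail hopf (F := fun p z => sw (fun y1 y2 =>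
      (f (p * y1) : K) *: (S z * (S (S y2) * x))) y)); sl.
  apply: eq_sw => y1 y2; rewrite comp_lfunE amullE antipode1 mul1r.
  by rewrite !linearZ /= scalerAl.
rewrite trace_sw.
transitivity (sw (fun a b => tr (X \o (amull a \o amull (S b)))%VF : K^o) h).
  by apply: eq_sw => a b; rewrite -comp_lfunA lfun_traceC comp_lfunA.
rewrite -(sw_map hopf (g := fun Y : 'End(H) => tr (X \o Y)%VF : K^o)); last first.
  apply: (lin_comp (@lfun_trace_lin K H)) => a Y Z.
  by rewrite comp_lfunDr -comp_lfunZr.
have -> : sw (fun a b => (amull a \o amull (S b))%VF) h = (eps h : K) *: \1%VF.
  apply/lfunP=> y; rewrite sw_lfun scale_lfunE id_lfunE -[in RHS](mul1r y).
  rewrite -(sw_Sr hopf (F := fun z => z * y)); last by slin.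
  by apply: eq_sw => a b; rewrite comp_lfunE !amullE mulrA.
by rewrite -comp_lfunZr comp_lfun1r (linZ _ _ (@lfun_trace_lin K H)).
Qed.

Definition is_character f := f 1 = 1 /\ forall x y, f (x * y) = f x * f y.

(** Averaging a linear projection onto [I] over [L] gives an [H]-linear map [pi] into [I] that acts
    on [I] as the nonzero scalar [eps L]; its kernel is the complement. *)
Lemma maschke L : left_integral L -> eps L != 0 -> semisimple_alg H.
Proof.
move=> intL epsL I idI.
have IM y : forall x, x \in I -> y * x \in I.
  by move=> x xI; apply: (subvP idI); apply: memv_mul => //; apply: memvf.
pose pi x := sw (fun a b => a * projv I (S b * x)) L.
have lin_pi : lin pi by rewrite /pi; slin.
(* The Casimir property of [L_(1) (x) S L_(2)]: left multiplication of the first leg by [h] equals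
   right multiplication of the second. It makes [pi] linear over [H]. *)
have key W (F : H -> H -> W) h : (forall b, lin (F^~ b)) -> (forall a, lin (F a)) ->
    sw (fun a b => F (h * a) (S b)) L = sw (fun a b => F a (S b * h)) L.
  move=> F1 F2.
  have lF2 U (g : U -> H) c : lin g -> lin (fun z => F c (g z)).
    by move=> lg; apply: lin_comp.
  have lF1 U (g : U -> H) c : lin g -> lin (fun z => F (g z) c).
    by move=> lg; apply: (lin_comp (g := F^~ c)).
  transitivity (sw (fun u c => sw (fun p q => F p (S q * c)) (u * L)) h).
    under [RHS]eq_sw => u c do [rewrite (swM hopf (F := fun p q => F p (S q * c))); sl].
    rewrite (sw_assoc hopf (F := fun h1 h2 c =>
      sw (fun a b => F (h1 * a) (S (h2 * b) * c)) L)); sl.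
    transitivity (sw (fun h1 v => sw (fun h2 c =>
        sw (fun a b => F (h1 * a) (S b * (S h2 * c))) L) v) h).
      rewrite (sw_Sl_tail hopf (F := fun h1 z =>
        sw (fun a b => F (h1 * a) (S b * z)) L)); sl.
      by apply: eq_sw => a b; rewrite mulr1.
    apply: eq_sw => h1 v; apply: eq_sw => h2 c; apply: eq_sw => a b.
    by rewrite antipodeM mulrA.
  rewrite -[RHS](sw_counitl hopf (F := fun c => sw (fun p q => F p (S q * c)) L)); sl.
  apply: eq_sw => u c; rewrite intL.
  by rewrite (linZ _ _ (lin_sw hopf _ (@lin_id K H))).
have piM h x : pi (h * x) = h * pi x.
  rewrite /pi (sw_map hopf (g := fun z => h * z)); last by slin.
  transitivity (sw (fun a b => a * projv I (S b * h * x)) L).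
    by apply: eq_sw => a b; rewrite mulrA.
  rewrite -(key _ (fun a b => a * projv I (b * x))); sl.
  by apply: eq_sw => a b; rewrite mulrA.
have pi_in x : pi x \in I.
  rewrite /pi /sweedler /tens_lift; apply: memv_suml => i _; apply: memv_suml => j _.
  by apply: memvZ; apply: IM; apply: memv_proj.
have pi_id x : x \in I -> pi x = (eps L : K) *: x.
  move=> xI; rewrite -[in RHS](mul1r x) -(sw_Sr hopf (F := fun z => z * x)); last by slin.
  by apply: eq_sw => a b; rewrite projv_id ?mulrA //; apply: IM.
pose J := lker (mkhom lin_pi).
have JE x : (x \in J) = (pi x == 0) by rewrite memv_ker mkhomE.
exists J; split.
- apply/prodvP=> h x _; rewrite !JE piM => /eqP->.
  by rewrite mulr0.
- apply/eqP; rewrite eqEsubv subvf; apply/subvP=> x _.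
  rewrite -(subrK ((eps L : K)^-1 *: pi x) x) addrC; apply: memv_add.
    by apply: memvZ; apply: pi_in.
  rewrite JE; apply/eqP; rewrite -[pi _]/(mklin lin_pi _) linearB linearZ /=.
  by rewrite (pi_id _ (pi_in x)) scalerA mulVf // scale1r subrr.
- apply/eqP; rewrite -subv0; apply/subvP=> x /memv_capP[xI].
  by rewrite JE pi_id // scaler_eq0 (negPf epsL) memv0.
Qed.

(** For the integral [L] representing the trace, [f h * f L = f (h * L) = eps h * f L]. If [f L]
    were nonzero, [f] would be the counit, which kills [L] by [maschke]. *)
Lemma trace_vanish x f : ~ semisimple_alg H -> is_character f ->
  tr (amulr x \o T \o hitby f)%VF = 0.
Proof.
move=> nss [f1 fM]; have [L intL <-] := trace_left_integral x.
have [e0|/maschke ss] := eqVneq (eps L) 0; last by case: nss; apply: ss.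
apply/eqP; apply: contraT => fL.
suff fE h : f h = eps h by rewrite fE e0 eqxx in fL.
by apply: (mulIf fL); rewrite -fM intL linearZ.
Qed.

End Operators.

(** * Integrals of the dual algebra *)

Section Integral.
Variables (K : fieldType) (H : falgType K) (hopf : hopf_algebra H).
Implicit Types U V W : vectType K.
Implicit Types (f g : 'Hom(H, K^o)) (x y h : H).
Local Notation eps := (counit hopf).
Local Notation S := (antipode hopf).
Local Notation sw := (sweedler hopf).
Local Notation hit := (hit hopf).
Local Notation hitby := (hitby hopf).
Local Notation tr := lfun_trace.
Local Notation T := (S \o S)%VF.
Local Notation e := (vbasis {:H}).

(** Tested against functionals, this says that [f] is a left integral for the convolution product of
    the dual, whose counit is evaluation at 1. *)
Definition dual_left_integral f :=
  forall x, sw (fun a b => (f b : K) *: a) x = (f x : K) *: 1.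

Lemma dual_basis_sum x : \sum_i (dual_basis i x : K) *: e`_i = x.
Proof.
rewrite [RHS](coord_vbasis (memvf x)).
by apply: eq_bigr => i _; rewrite dual_basisE.
Qed.

Lemma lin_expand W (F : H -> W) x : lin F ->
  F x = \sum_i (dual_basis i x : K) *: F e`_i.
Proof.
move=> lF; rewrite -{1}(dual_basis_sum x) -[F _]/(mklin lF _) linear_sum.
by apply: eq_bigr => i _; rewrite linearZ.
Qed.

Lemma sw_sum W (I : finType) (F : I -> H -> H -> W) x :
  \sum_i sw (F i) x = sw (fun a b => \sum_i F i a b) x.
Proof.
rewrite /sweedler /tens_lift exchange_big; apply: eq_bigr => i _.
by rewrite exchange_big; apply: eq_bigr => j _; rewrite scaler_sumr.
Qed.

Lemma trace_sum (I : finType) (F : I -> 'End(H)) : \sum_i tr (F i) = tr (\sum_i F i).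
Proof. by rewrite -[RHS]/(mklin (@lfun_trace_lin K H) _) linear_sum. Qed.

Lemma hitby_comp f g h :
  hitby g (hitby f h) = sw (fun a b => sw (fun c d => (f a : K) *: ((g c : K) *: d)) b) h.
Proof.
rewrite [hitby f h]hitbyE (sw_map hopf (g := fun z => hitby g z)); last by slin.
apply: eq_sw => a b; rewrite linearZ /= hitbyE.
by rewrite (sw_map hopf (g := fun z => (f a : K) *: z)); slin.
Qed.

Lemma trace_dual_integral_lin f :
  lin (fun y => tr (amull y \o (T \o hit f))%VF : K^o).
Proof.
apply: (lin_comp (@lfun_trace_lin K H)) => a x y.
by rewrite linearP /= comp_lfunDl -comp_lfunZl.
Qed.

Definition trace_dual_integral f : 'Hom(H, K^o) := mkhom (@trace_dual_integral_lin f).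

(** Dual to [trace_left_integral]: tested against [psi], the operator is a sum of composites with
    [X y] between two [hitby] factors. Cyclicity of the trace makes these adjacent, and the antipode
    axiom then contracts them to the scalar [psi 1]. *)
Lemma trace_dual_integralP f : dual_left_integral (trace_dual_integral f).
Proof.
move=> y; apply: hom_separate => psi.
pose lam := trace_dual_integral f; rewrite -/lam.
rewrite (sw_map hopf (g := fun z => psi z)); last by slin.
have lamE z : lam z = tr (amull z \o (T \o hit f))%VF by apply: mkhomE.
pose X z := (amull z \o (T \o hit f))%VF.
have XE z h : X z h = sw (fun a b => (f b : K) *: (z * S (S a))) h.
  rewrite !comp_lfunE amullE hitE (sw_map hopf (g := fun t => z * S (S t))); last by slin.
  by apply: eq_sw => a b; rewrite !linearZ /= -scalerAr.
have {}lamE z : lam z = tr (X z) := lamE z.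
clearbody X.
have key h : sw (fun a b => (psi a : K) *: X b h) y =
    sw (fun c d => sw (fun p q => (psi (p * S c) : K) *: q) (X y d)) h.
  transitivity (sw (fun c d => sw (fun r s => (f s : K) *:
      sw (fun a b => sw (fun u v =>
        (psi (a * (S (S u) * S c)) : K) *: (b * S (S v))) r) y) d) h); last first.
    apply: eq_sw => c d; rewrite XE.
    rewrite (sw_map hopf (g := fun z => sw (fun p q => (psi (p * S c) : K) *: q) z));
      last by slin.
    apply: eq_sw => r s; rewrite (linZ _ _ (lin_sw hopf _ (@lin_id K H))).
    congr (_ *: _); rewrite swM; sl; apply: eq_sw => a b.
    rewrite swSS; sl; apply: eq_sw => u v.
    by rewrite mulrA.
  transitivity (sw (fun a b => sw (fun c d => sw (fun u z => sw (fun v s =>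
     (f s : K) *: ((psi (a * S (c * S u)) : K) *: (b * S (S v)))) z) d) h) y).
    apply: eq_sw => a b; rewrite XE (sw_map hopf (g := fun z => (psi a : K) *: z));
      last by slin.
    rewrite (sw_Sr_head hopf (F := fun w z => sw (fun v s =>
      (f s : K) *: ((psi (a * S w) : K) *: (b * S (S v)))) z)); sl.
    by apply: eq_sw => v s; rewrite antipode1 mulr1 !scalerA mulrC.
  rewrite sw_exchange; apply: eq_sw => c d.
  transitivity (sw (fun a b => sw (fun r s => sw (fun u v =>
     (f s : K) *: ((psi (a * S (c * S u)) : K) *: (b * S (S v)))) r) d) y).
    by apply: eq_sw => a b; rewrite -(sw_assoc hopf (F := fun u v s =>
      (f s : K) *: ((psi (a * S (c * S u)) : K) *: (b * S (S v))))); sl.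
  rewrite sw_exchange; apply: eq_sw => r s.
  rewrite (sw_map hopf (g := fun z => (f s : K) *: z)); last by slin.
  apply: eq_sw => a b; rewrite (sw_map hopf (g := fun z => (f s : K) *: z)); last by slin.
  by apply: eq_sw => u v; rewrite antipodeM.
transitivity (tr (sw (fun a b => (psi a : K) *: X b) y)).
  rewrite trace_sw; apply: eq_sw => a b.
  by rewrite linearZ (linZ _ _ (@lfun_trace_lin K H)) /= lamE; apply: mulrC.
pose psi_ (i : 'I_(\dim {:H})) := (psi \o amulr e`_i)%VF.
transitivity (\sum_i tr (hitby (psi_ i) \o (X y \o hitby (dual_basis i \o S)))%VF).
  rewrite trace_sum; set Y := (\sum_i _)%R.
  suff -> : sw (fun a b => (psi a : K) *: X b) y = Y by [].
  rewrite /Y; apply/lfunP=> h; rewrite sw_lfun sum_lfunE.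
  under eq_sw => a b do rewrite scale_lfunE.
  rewrite key; under [RHS]eq_bigr => i _ do
    [rewrite !comp_lfunE [hitby (dual_basis i \o S) h]hitbyE
      (sw_map hopf (g := fun z => hitby (psi_ i) (X y z))); sl].
  rewrite sw_sum; apply: eq_sw => c d.
  rewrite (lin_expand (F := fun z => sw (fun p q => (psi (p * z) : K) *: q) (X y d)));
    last by slin.
  apply: eq_bigr => i _; rewrite comp_lfunE !linearZ /= hitbyE; congr (_ *: _).
  by apply: eq_sw => p q; rewrite comp_lfunE amulrE.
transitivity (\sum_i tr (X y \o (hitby (dual_basis i \o S) \o hitby (psi_ i)))%VF).
  by apply: eq_bigr => i _; rewrite lfun_traceC comp_lfunA.
rewrite trace_sum linearZ.
have -> : \sum_i (X y \o (hitby (dual_basis i \o S) \o hitby (psi_ i)))%VF =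
    (psi 1 : K) *: X y.
  apply/lfunP=> h; rewrite sum_lfunE scale_lfunE.
  under eq_bigr => i _ do rewrite comp_lfunE comp_lfunE hitby_comp.
  rewrite -linear_sum sw_sum -linearZ; congr (X y _).
  transitivity (sw (fun a b => sw (fun c d => (psi (a * S c) : K) *: d) b) h).
    apply: eq_sw => a b; rewrite sw_sum; apply: eq_sw => c d.
    rewrite (lin_expand (F := fun z => (psi (a * z) : K) *: d)); last by slin.
    apply: eq_bigr => i _; rewrite !comp_lfunE amulrE !scalerA.
    by congr (_ *: _); apply: mulrC.
  by rewrite (sw_Sr_head hopf (F := fun z d => (psi z : K) *: d)); sl.
rewrite (linZ _ _ (@lfun_trace_lin K H)) lamE; exact: mulrC.
Qed.

(** The identity [h_(3) * S h_(2) * S (S h_(1)) = h] writes the identity operator as a sum of the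
    operators traced in [trace_dual_integral]. If all the values involved vanished, so would its
    trace, the dimension. *)
Lemma exists_dual_left_integral : (\dim {:H})%:R != 0 :> K ->
  exists2 f, dual_left_integral f & f != 0.
Proof.
move=> dim0; pose F h := sw (fun a b => b * S a) h.
have lF : lin F by rewrite /F; slin.
have [/existsP[i lam_i]|/existsPn lam0] :=
    boolP [exists i, trace_dual_integral (dual_basis i) (F e`_i) != 0].
  exists (trace_dual_integral (dual_basis i)); first exact: trace_dual_integralP.
  by apply: contra lam_i => /eqP->; rewrite zero_lfunE.
case/eqP: dim0; rewrite -lfun_trace1.
transitivity (\sum_i trace_dual_integral (dual_basis i) (F e`_i)); last first.
  by apply: big1 => i _; have := lam0 i; rewrite negbK => /eqP.
under eq_bigr => i _ do rewrite mkhomE.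
rewrite trace_sum; set Y := (\sum_i _)%R; suff -> : Y = \1%VF by [].
rewrite /Y; apply/lfunP=> h; rewrite id_lfunE sum_lfunE.
under eq_bigr => i _ do [rewrite !comp_lfunE amullE hitE
  (sw_map hopf (g := fun z => F e`_i * S (S z))); sl].
rewrite sw_sum.
transitivity (sw (fun a b => F b * S (S a)) h); last first.
  rewrite /F; under eq_sw => a b do
    [rewrite (sw_map hopf (g := fun z => z * S (S a))); sl].
  transitivity (sw (fun a u => sw (fun b c => c * S (S a * b)) u) h).
    apply: eq_sw => a u; apply: eq_sw => b c.
    by rewrite antipodeM mulrA.
  rewrite (sw_Sl_head hopf (F := fun z c => c * S z)); sl.
  by rewrite antipode1 mulr1.
apply: eq_sw => a b; rewrite [RHS](lin_expand (F := fun z => F z * S (S a))); last first.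
  by apply: lin_mulr.
by apply: eq_bigr => i _; rewrite !linearZ /= -scalerAr.
Qed.

End Integral.

(** * Frobenius property and Radford's formula *)

Section Frobenius.
Variables (K : fieldType) (H : falgType K) (hopf : hopf_algebra H).
Implicit Types U V W : vectType K.
Implicit Types (f : 'Hom(H, K^o)) (x y h : H).
Local Notation eps := (counit hopf).
Local Notation S := (antipode hopf).
Local Notation sw := (sweedler hopf).
Local Notation hit := (hit hopf).
Local Notation hitby := (hitby hopf).
Local Notation T := (S \o S)%VF.
Local Notation e := (vbasis {:H}).

Variable lam : 'Hom(H, K^o).
Hypotheses (lamI : dual_left_integral hopf lam) (lam_neq0 : lam != 0).

(** Apply the invariance of [lam] to [x_(2) * y] and cancel the new factor against [S x_(1)]. *)
Lemma integral_shift x y :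
  sw (fun a b => (lam (b * y) : K) *: S a) x = sw (fun c d => (lam (x * d) : K) *: c) y.
Proof.
transitivity (sw (fun a u => sw (fun b c => sw (fun d g =>
    (lam (c * g) : K) *: (S a * b * d)) y) u) x); last first.
  rewrite (sw_Sl_head hopf (F := fun z c => sw (fun d g =>
    (lam (c * g) : K) *: (z * d)) y)); sl.
  by apply: eq_sw => c d; rewrite mul1r.
apply: eq_sw => a u.
transitivity (S a * sw (fun p q => (lam q : K) *: p) (u * y)).
  by rewrite lamI -scalerAr mulr1.
rewrite (sw_map hopf (g := fun z => S a * z)); last by slin.
rewrite swM; sl; apply: eq_sw => b c; apply: eq_sw => d g.
by rewrite -scalerAr mulrA.
Qed.

(* The kernel of the form is a left ideal and a left coideal; hence it contains
   [eps z *: 1] for each of its elements [z]. *)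
Lemma integral_nondegenerate y : (forall x, lam (x * y) = 0) -> y = 0.
Proof.
pose N y := forall x, lam (x * y) = 0.
have N_hitby z f : N z -> N (hitby f z).
  move=> Nz x; rewrite hitbyE (sw_map hopf (g := fun t => lam (x * t))); last by slin.
  transitivity (f (sw (fun c d => (lam (x * d) : K) *: c) z)).
    rewrite (sw_map hopf (g := fun t => f t)); last by slin.
    by apply: eq_sw => a b; rewrite -scalerAr !linearZ; apply: mulrC.
  rewrite -integral_shift (sw_map hopf (g := fun t => f t)); last by slin.
  rewrite /sweedler /tens_lift big1 // => i _; rewrite big1 // => j _.
  by rewrite Nz scale0r linear0 scaler0.
have N_eps z : N z -> eps z = 0.
  move=> Nz; have Neps : N ((eps z : K) *: 1).
    rewrite -(sw_Sl hopf (F := fun t => t)); last by slin.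
    have -> : sw (fun a b => S a * b) z =
        \sum_(i < \dim {:H}) S e`_i * hitby (dual_basis i) z.
      under eq_bigr => i _ do
        [rewrite hitbyE (sw_map hopf (g := fun t => S e`_i * t)); sl].
      rewrite sw_sum; apply: eq_sw => a b.
      rewrite (lin_expand (F := fun t => S t * b)); last by slin.
      by apply: eq_bigr => i _; rewrite -scalerAr.
    move=> x; rewrite mulr_sumr linear_sum big1 // => i _.
    by rewrite mulrA; apply: N_hitby.
  apply/eqP; apply: contraT => ez; case/eqP: lam_neq0; apply/lfunP=> x.
  have := Neps x; rewrite -scalerAr mulr1 linearZ zero_lfunE => /eqP.
  by rewrite scaler_eq0 (negPf ez) => /eqP.
move=> Ny; apply: hom_separate => f; rewrite linear0.
rewrite -(N_eps _ (N_hitby y f Ny)) hitbyE.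
rewrite (sw_map hopf (g := fun t => eps t)); last by slin.
under eq_sw => a b do rewrite linearZ.
rewrite -[LHS](sw_counitr hopf (F := fun a => f a)); last by slin.
by apply: eq_sw => a b; apply: mulrC.
Qed.

Definition gram : 'M[K]_(\dim {:H}) :=
  \matrix_(i, j) lam (e`_i * e`_j).

Lemma gramE x y :
  lam (x * y) = (passmx.rVof e x *m gram *m (passmx.rVof e y)^T) 0 0.
Proof.
rewrite {1}(coord_vbasis (memvf x)) {1}(coord_vbasis (memvf y)) mulr_sumr linear_sum.
rewrite mxE; apply: eq_bigr => j _; rewrite mulr_suml linear_sum !mxE mulr_suml.
apply: eq_bigr => i _ /=; rewrite !mxE -scalerAl -scalerAr !linearZ.
by rewrite -!mulrA; congr (_ * _); apply: mulrC.
Qed.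

Lemma gram_unit : gram \in unitmx.
Proof.
rewrite -unitmx_tr -row_free_unit -kermx_eq0; apply/rowV0P => v /sub_kermxP vG.
apply/eqP; rewrite -(passmx.vecof_eq0 (vbasisP {:H})); apply/eqP.
apply: integral_nondegenerate => x; rewrite gramE passmx.vecofK ?vbasisP //.
by rewrite -mulmxA -[gram]trmxK -trmx_mul vG trmx0 mulmx0 mxE.
Qed.

Lemma integral_represents f : exists a, forall x, f x = lam (x * a).
Proof.
pose m : 'cV[K]_(\dim {:H}) := \col_i f e`_i.
exists (passmx.vecof e (invmx gram *m m)^T) => x.
rewrite gramE passmx.vecofK ?vbasisP // trmxK mulmxA mulmxK ?gram_unit //.
rewrite {1}(coord_vbasis (memvf x)) linear_sum mxE.
by apply: eq_bigr => i _; rewrite !mxE linearZ.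
Qed.

Lemma integral_represents_left f : exists a, forall x, f x = lam (a * x).
Proof.
pose m : 'rV[K]_(\dim {:H}) := \row_i f e`_i.
exists (passmx.vecof e (m *m invmx gram)) => x.
rewrite gramE passmx.vecofK ?vbasisP // mulmxKV ?gram_unit //.
rewrite {1}(coord_vbasis (memvf x)) linear_sum mxE.
by apply: eq_bigr => i _; rewrite !mxE linearZ; apply: mulrC.
Qed.

(** With [z] representing the counit through [lam], [integral_shift] sends the proposed preimage to
    the sum of the [lam (z * y_(2)) *: y_(1)], which is [y]. *)
Lemma antipode_surjective y : exists x, S x = y.
Proof.
have [z zE] := integral_represents_left eps.
exists (sw (fun a b => (lam (b * y) : K) *: a) z).
rewrite (sw_map hopf (g := fun t => S t)); last by slin.
under eq_sw => a b do rewrite linearZ /=.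
rewrite integral_shift -[RHS](sw_counitr hopf (F := fun t => t)); last by slin.
by apply: eq_sw => a b; rewrite -zE.
Qed.

(* The matrix of [sigma] is the quotient of the Gram matrix by its transpose. *)
Lemma nakayama : exists2 sigma : 'End(H),
  forall x y, lam (x * y) = lam (y * sigma x) & \det (passmx.mxof e e sigma) = 1.
Proof.
pose M := gram *m invmx gram^T.
exists (passmx.hommx e e M); last first.
  rewrite passmx.hommxK ?vbasisP // det_mulmx det_inv det_tr divff //.
  by have := gram_unit; rewrite unitmxE unitfE.
move=> x y; rewrite !gramE -passmx.rVof_mul ?vbasisP //.
set u := passmx.rVof e x; set v := passmx.rVof e y.
have -> : v *m gram *m (u *m M)^T = (u *m gram *m v^T)^T; last by rewrite [RHS]mxE.
by rewrite /M !trmx_mul trmx_inv !trmxK !mulmxA mulmxK ?gram_unit.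
Qed.

(** Write [f] as [lam (_ * a)]. Invariance of [f] and [integral_shift] give [shift]; at the element
    representing the counit it says that [a] is a scalar. *)
Lemma dual_left_integral_unique f : dual_left_integral hopf f ->
  exists c : K, forall x, f x = c * lam x.
Proof.
move=> fI; have [a fE] := integral_represents f.
suff aE : a = (eps a : K) *: 1.
  exists (eps a) => x; rewrite fE {1}aE -scalerAr mulr1 linearZ; exact: erefl.
have [z zE] := integral_represents_left eps.
have shift y : sw (fun c d => (lam (y * d) : K) *: c) a = (lam (y * a) : K) *: 1.
  rewrite -integral_shift; transitivity (S (sw (fun b c => (f c : K) *: b) y)).
    rewrite (sw_map hopf (g := fun t => S t)); last by slin.
    by apply: eq_sw => b c; rewrite linearZ /= fE.
  by rewrite fI linearZ /= antipode1 fE.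
rewrite -[LHS](sw_counitr hopf (F := fun t => t)); last by slin.
under eq_sw => c d do rewrite zE.
by rewrite shift -zE.
Qed.

(* [Delta x = x (x) x], tested against bilinear maps. *)
Definition grouplike x := forall (W : vectType K) (F : H -> H -> W),
  (forall b, lin (F^~ b)) -> (forall a, lin (F a)) -> sw F x = F x x.

(** For every [psi], the functional [x |-> lam x_(1) * psi x_(2)] is again an integral, hence a
    multiple of [lam]. Normalizing at [u] identifies the factor as [psi g]; coassociativity then
    makes [g] group-like. *)
Lemma distinguished_grouplike : exists g : H, [/\ eps g = 1, grouplike g &
  forall x, sw (fun a b => (lam a : K) *: b) x = (lam x : K) *: g].
Proof.
have [u lam_u] : exists u, lam u = 1.
  have [z zE] := integral_represents_left eps.
  by exists (z * 1); rewrite -zE counit1.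
pose G x := sw (fun a b => (lam a : K) *: b) x.
pose g := G u.
have gE x : G x = (lam x : K) *: g.
  apply: hom_separate => psi.
  have mu_lin : lin (fun x => psi (G x)) by rewrite /G; slin.
  have [|c muE] := @dual_left_integral_unique (mkhom mu_lin).
    move=> t; under eq_sw => a b do [rewrite mkhomE /G
      (sw_map hopf (g := fun s => (psi s : K) *: a)); sl].
    rewrite mkhomE /G (sw_map hopf (g := fun s => (psi s : K) *: (1 : H))); last by slin.
    transitivity (sw (fun a v => sw (fun b c => (psi c : K) *: ((lam b : K) *: a)) v) t).
      apply: eq_sw => a b; apply: eq_sw => p q; rewrite linearZ !scalerA.
      by congr (_ *: _); apply: mulrC.
    rewrite -(sw_assoc hopf (F := fun a b c => (psi c : K) *: ((lam b : K) *: a))); sl.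
    apply: eq_sw => w c; rewrite linearZ -(sw_map hopf (g := fun s => (psi c : K) *: s));
      last by slin.
    by rewrite lamI !scalerA; congr (_ *: _); apply: mulrC.
  have xE := muE x; have := muE u; rewrite !mkhomE lam_u mulr1 -/g in xE * => gc.
  by rewrite xE -gc linearZ; apply: mulrC.
have sw_g W (F : H -> W) x : lin F ->
    sw (fun a b => (lam a : K) *: F b) x = (lam x : K) *: F g.
  move=> lF; rewrite -(linZ _ _ lF) -gE /G (sw_map hopf (g := F)) //.
  by apply: eq_sw => a b; rewrite (linZ _ _ lF).
exists g; split=> [||x]; last exact: gE.
  rewrite -lam_u -(sw_counitr hopf (F := fun t => lam t)); last by slin.
  rewrite /g /G (sw_map hopf (g := fun t => eps t)); last by slin.
  by apply: eq_sw => a b; rewrite linearZ; apply: mulrC.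
move=> W F F1 F2.
have lF2 U (f : U -> H) c : lin f -> lin (fun z => F c (f z)).
  by move=> lf; apply: lin_comp.
have lF1 U (f : U -> H) c : lin f -> lin (fun z => F (f z) c).
  by move=> lf; apply: (lin_comp (g := F^~ c)).
transitivity (sw (fun a b => (lam a : K) *: sw F b) u).
  by rewrite sw_g ?lam_u ?scale1r //; slin.
transitivity (sw (fun a v => sw (fun p q => (lam a : K) *: F p q) v) u).
  apply: eq_sw => a b.
  by rewrite (sw_map hopf (g := fun t => (lam a : K) *: t)) //; slin.
rewrite -(sw_assoc hopf (F := fun a p q => (lam a : K) *: F p q)); sl.
transitivity (sw (fun w q => (lam w : K) *: F g q) u).
  by apply: eq_sw => w q; rewrite (sw_g _ (F^~ q)).
by rewrite sw_g ?lam_u ?scale1r.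
Qed.

(** The counterpart of [integral_shift] on the other side, where invariance of [lam] costs the
    factor [g]. *)
Lemma integral_shift_grouplike g x y :
    (forall x, sw (fun a b => (lam a : K) *: b) x = (lam x : K) *: g) ->
  sw (fun a b => (lam (a * y) : K) *: b) x =
  sw (fun c d => (lam (x * c) : K) *: (g * S d)) y.
Proof.
move=> gE.
transitivity (sw (fun c v => sw (fun d t => sw (fun a b =>
    (lam (a * c) : K) *: (b * (d * S t))) x) v) y).
  rewrite (sw_Sr_tail hopf (F := fun c z => sw (fun a b =>
    (lam (a * c) : K) *: (b * z)) x)); sl.
  by apply: eq_sw => a b; rewrite mulr1.
rewrite -(sw_assoc hopf (F := fun c d t => sw (fun a b =>
    (lam (a * c) : K) *: (b * (d * S t))) x)); sl.
apply: eq_sw => w t; rewrite sw_exchange.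
transitivity (sw (fun p q => (lam p : K) *: q) (x * w) * S t); last first.
  by rewrite gE -scalerAl.
rewrite (sw_map hopf (g := fun s => s * S t)); last by slin.
rewrite swM; sl; apply: eq_sw => a b; apply: eq_sw => c d.
by rewrite -scalerAl mulrA.
Qed.

Lemma radford_formula : exists g alpha,
  [/\ eps g = 1, grouplike g, is_character alpha,
      forall x, hitby alpha x = g * T (T (hit alpha x)) * S g &
      \det (passmx.mxof e e (T \o hit alpha)%VF) = 1].
Proof.
have [g [eps_g grp_g gE]] := distinguished_grouplike.
have [sigma sigmaE det_sigma] := nakayama.
have [z zE] := integral_represents_left eps.
have eq_lam y y' : (forall x, lam (x * y) = lam (x * y')) -> y = y'.
  move=> yy'; apply/eqP; rewrite -subr_eq0; apply/eqP.
  by apply: integral_nondegenerate => x; rewrite mulrBr linearB /= yy' subrr.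
(* By nondegeneracy [sigma] is an algebra map, which makes [alpha] a character. *)
have sigma1 : sigma 1 = 1 by apply: eq_lam => x; rewrite -sigmaE mul1r mulr1.
have sigmaM x y : sigma (x * y) = sigma x * sigma y.
  by apply: eq_lam => t; rewrite -sigmaE -mulrA sigmaE -mulrA sigmaE mulrA.
pose alpha := (eps \o sigma)%VF.
have alphaE x : alpha x = lam (x * z) by rewrite comp_lfunE /= zE -sigmaE.
(* [integral_shift] is used twice, with [sigmaE] moving a factor across in between; [z] then acts as
   the counit. *)
have sigma_hit x : sigma x = T (hit alpha x).
  rewrite comp_lfunE hitE (sw_map hopf (g := fun t => S (S t))); last by slin.
  transitivity (S (sw (fun a b => (lam (b * z) : K) *: S a) x)); last first.
    rewrite (sw_map hopf (g := fun t => S t)); last by slin.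
    by apply: eq_sw => a b; rewrite !linearZ /= alphaE.
  rewrite integral_shift (sw_map hopf (g := fun t => S t)); last by slin.
  under [RHS]eq_sw => c d do rewrite linearZ /= sigmaE.
  rewrite integral_shift -[LHS](sw_counitr hopf (F := fun t => t)); last by slin.
  by apply: eq_sw => c d; rewrite zE.
exists g, alpha; split=> //.
- split; first by rewrite comp_lfunE sigma1 counit1.
  by move=> x y; rewrite !comp_lfunE sigmaM counitM.
(* The same computation with [integral_shift_grouplike] contributes [g] and an antipode twice,
   giving [g * S (g * S (sigma x))]. *)
- move=> x; rewrite -sigma_hit hitbyE comp_lfunE.
  under eq_sw => a b do rewrite alphaE.
  rewrite (integral_shift_grouplike _ _ gE).
  transitivity (g * S (sw (fun c d => (lam (c * sigma x) : K) *: d) z)).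
    rewrite (sw_map hopf (g := fun t => g * S t)); last by slin.
    by apply: eq_sw => c d; rewrite linearZ -scalerAr sigmaE.
  rewrite (integral_shift_grouplike _ _ gE) -mulrA -antipodeM; congr (_ * S _).
  transitivity (g * S (sw (fun c d => (eps c : K) *: d) (sigma x))).
    rewrite (sw_map hopf (g := fun t => g * S t)); last by slin.
    by apply: eq_sw => c d; rewrite linearZ -scalerAr zE.
  by rewrite (sw_counitl hopf (F := fun t => t)); sl.
- rewrite -[RHS]det_sigma; congr (\det (passmx.mxof _ _ _)).
  by apply/lfunP => x; rewrite sigma_hit [LHS]comp_lfunE.
Qed.

End Frobenius.

(** * Orders of group-like elements and of characters *)

Import FalgLfun.

Section Matrices.
Variables (K : fieldType) (H : falgType K).
Implicit Types (f g : 'End(H)) (x y h : H).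
Local Notation e := (vbasis {:H}).
Local Notation n := (\dim {:H}).

Definition mx f : 'M[K]_n := passmx.mxof e e f.

(** The product of ['End(H)] opened by [FalgLfun] composes from left to right,
    [(f * g) x = g (f x)], in agreement with matrices acting on row vectors. *)
Lemma mxM f g : mx (f * g) = mx f * mx g.
Proof. exact: (passmx.mxof_comp _ _ (vbasisP {:H})). Qed.

Lemma mx1 : mx 1 = 1.
Proof. exact: passmx.mxof1 (basis_free (vbasisP {:H})). Qed.

Lemma mxX f i : mx (f ^+ i) = mx f ^+ i.
Proof. by elim: i => [|i IHi]; rewrite ?mx1 // !exprS mxM IHi. Qed.

Lemma mx_inj : injective mx.
Proof. exact: (can_inj (passmx.mxofK (vbasisP {:H}) (vbasisP {:H}))). Qed.

Lemma tens_pure_mx x y :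
  x \ot y = (passmx.rVof e x)^T *m passmx.rVof e y :> 'M[K]_n.
Proof. by apply/matrixP=> i j; rewrite !mxE big_ord1 !mxE. Qed.

Lemma mx_tens_pure f g x y :
  (mx f)^T *m (x \ot y : 'M_n) *m mx g = f x \ot g y.
Proof.
rewrite !tens_pure_mx !(passmx.rVof_app _ (vbasisP {:H})) trmx_mul !mulmxA.
by [].
Qed.

Lemma mx_tens_purel f x y : (mx f)^T *m (x \ot y : 'M_n) = f x \ot y.
Proof. by have := mx_tens_pure f 1 x y; rewrite mx1 mulmx1 id_lfunE. Qed.

Lemma mx_tens_purer f x y : (x \ot y : 'M_n) *m mx f = x \ot f y.
Proof. by have := mx_tens_pure 1 f x y; rewrite mx1 trmx1 mul1mx id_lfunE. Qed.

Lemma eq_tens_lin (W : vectType K) (F G : tensv H H -> W) :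
  lin F -> lin G -> (forall x y, F (x \ot y) = G (x \ot y)) -> F =1 G.
Proof.
move=> lF lG FG t; rewrite -[F t]/(mklin lF t) -[G t]/(mklin lG t).
exact: (@tens_ext K H H W (mklin lF) (mklin lG)).
Qed.

End Matrices.

(** * Bijections of the tensor square built from the coproduct *)

Section Intertwiners.
Variables (K : fieldType) (H : falgType K) (hopf : hopf_algebra H).
Hypothesis S_onto : forall y, exists x, antipode hopf x = y.
Implicit Types (f g : 'Hom(H, K^o)) (x y h : H).
Local Notation eps := (counit hopf).
Local Notation S := (antipode hopf).
Local Notation sw := (sweedler hopf).
Local Notation hit := (hit hopf).
Local Notation hitby := (hitby hopf).
Local Notation e := (vbasis {:H}).
Local Notation n := (\dim {:H}).

Lemma lker_antipode : lker S == 0%VS.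
Proof.
rewrite -dimv_eq0; have := limg_ker_dim S fullv; rewrite capfv.
have -> : (S @: fullv)%VS = fullv.
  apply/eqP; rewrite eqEsubv subvf; apply/subvP=> y _.
  by have [x <-] := S_onto y; apply: memv_img; apply: memvf.
by move/eqP; rewrite -{2}[\dim fullv]add0n eqn_add2r.
Qed.

Local Notation Si := (S^-1)%VF.

Lemma antipodeK x : Si (S x) = x.
Proof. by rewrite -comp_lfunE lker0_compVf ?id_lfunE // lker_antipode. Qed.

Lemma antipodeVK x : S (Si x) = x.
Proof. by have [y <-] := S_onto x; rewrite antipodeK. Qed.

(** The inverse of the antipode is an antipode for the opposite coproduct: applying [S] reduces this
    to the axiom for [S]. *)
Lemma sw_Sil (W : vectType K) (F : H -> W) x : lin F ->
  sw (fun a b => F (Si b * a)) x = (eps x : K) *: F 1.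
Proof.
move=> lF; rewrite -(sw_map hopf _ _ lF) -(linZ _ _ lF); congr (F _).
apply: (can_inj antipodeK); rewrite linearZ /= antipode1 //.
rewrite (sw_map hopf (g := fun t => S t)); last by slin.
rewrite -(sw_Sl hopf (F := fun t => t)); last by slin.
by apply: eq_sw => a b; rewrite antipodeM antipodeVK.
Qed.

Lemma sw_Sir (W : vectType K) (F : H -> W) x : lin F ->
  sw (fun a b => F (b * Si a)) x = (eps x : K) *: F 1.
Proof.
move=> lF; rewrite -(sw_map hopf _ _ lF) -(linZ _ _ lF); congr (F _).
apply: (can_inj antipodeK); rewrite linearZ /= antipode1 //.
rewrite (sw_map hopf (g := fun t => S t)); last by slin.
rewrite -(sw_Sr hopf (F := fun t => t)); last by slin.
by apply: eq_sw => a b; rewrite antipodeM antipodeVK.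
Qed.

Definition left_shift : tensv H H -> tensv H H :=
  tens_lift (fun x y => sw (fun a b => b \ot (a * y)) x).

Lemma left_shift_lin : lin left_shift.
Proof. by rewrite /left_shift; slin. Qed.

Lemma left_shiftE x y : left_shift (x \ot y) = sw (fun a b => b \ot (a * y)) x.
Proof. by rewrite /left_shift tens_lift_ot; slin. Qed.

(** The inverse sends [x (x) y] to the sum of the [x_(2) (x) Si x_(1) * y]. *)
Lemma left_shift_inj : injective left_shift.
Proof.
pose inv := tens_lift (fun x y => sw (fun a b => b \ot (Si a * y)) x).
have lin_inv : lin inv by rewrite /inv; slin.
apply: (can_inj (g := inv)).
apply: (eq_tens_lin (F := fun t => inv (left_shift t))) => [||x y].
- by apply: lin_comp => //; apply: left_shift_lin.
- exact: lin_id.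
rewrite left_shiftE (sw_map hopf _ _ lin_inv).
transitivity (sw (fun a u => sw (fun b c => c \ot (Si b * a * y)) u) x).
  apply: eq_sw => a u; rewrite /inv tens_lift_ot; sl.
  by apply: eq_sw => b c; rewrite mulrA.
rewrite -(sw_assoc hopf (F := fun a b c => c \ot (Si b * a * y))); sl.
under eq_sw => w c do [rewrite (sw_Sil (F := fun z => c \ot (z * y))); sl].
by rewrite (sw_counitl hopf (F := fun c => c \ot (1 * y))) ?mul1r; sl.
Qed.

Definition right_shift : tensv H H -> tensv H H :=
  tens_lift (fun x y => sw (fun a b => a \ot (y * b)) x).

Definition right_unshift : tensv H H -> tensv H H :=
  tens_lift (fun x y => sw (fun a b => a \ot (y * Si b)) x).

Lemma right_shift_lin : lin right_shift.
Proof. by rewrite /right_shift; slin. Qed.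

Lemma right_unshift_lin : lin right_unshift.
Proof. by rewrite /right_unshift; slin. Qed.

Lemma right_shiftE x y : right_shift (x \ot y) = sw (fun a b => a \ot (y * b)) x.
Proof. by rewrite /right_shift tens_lift_ot; slin. Qed.

Lemma right_unshiftE x y : right_unshift (x \ot y) = sw (fun a b => a \ot (y * Si b)) x.
Proof. by rewrite /right_unshift tens_lift_ot; slin. Qed.

Lemma right_unshiftK : cancel right_unshift right_shift.
Proof.
apply: (eq_tens_lin (F := fun t => right_shift (right_unshift t))) => [||x y].
- by apply: lin_comp; [apply: right_shift_lin | apply: right_unshift_lin].
- exact: lin_id.
rewrite right_unshiftE (sw_map hopf _ _ right_shift_lin).
under eq_sw => w c do rewrite right_shiftE.
rewrite (sw_assoc hopf (F := fun a b c => a \ot (y * Si c * b))); sl.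
transitivity (sw (fun a v => sw (fun b c => a \ot (y * (Si c * b))) v) x).
  by apply: eq_sw => a v; apply: eq_sw => b c; rewrite mulrA.
under eq_sw => a v do [rewrite (sw_Sil (F := fun z => a \ot (y * z))); sl].
by rewrite (sw_counitr hopf (F := fun a => a \ot (y * 1))) ?mulr1; sl.
Qed.

Lemma right_shiftK : cancel right_shift right_unshift.
Proof.
apply: (eq_tens_lin (F := fun t => right_unshift (right_shift t))) => [||x y].
- by apply: lin_comp; [apply: right_unshift_lin | apply: right_shift_lin].
- exact: lin_id.
rewrite right_shiftE (sw_map hopf _ _ right_unshift_lin).
under eq_sw => w c do rewrite right_unshiftE.
rewrite (sw_assoc hopf (F := fun a b c => a \ot (y * c * Si b))); sl.
transitivity (sw (fun a v => sw (fun b c => a \ot (y * (c * Si b))) v) x).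
  by apply: eq_sw => a v; apply: eq_sw => b c; rewrite mulrA.
under eq_sw => a v do [rewrite (sw_Sir (F := fun z => a \ot (y * z))); sl].
by rewrite (sw_counitr hopf (F := fun a => a \ot (y * 1))) ?mulr1; sl.
Qed.

End Intertwiners.

(** * Characters and their two actions on the algebra *)

Section Characters.
Variables (K : fieldType) (H : falgType K) (hopf : hopf_algebra H).
Implicit Types (f g : 'Hom(H, K^o)) (x y h : H).
Local Notation eps := (counit hopf).
Local Notation S := (antipode hopf).
Local Notation sw := (sweedler hopf).
Local Notation hit := (hit hopf).
Local Notation hitby := (hitby hopf).
Local Notation T := (S * S).

Lemma hitM f x y : is_character f -> hit f (x * y) = hit f x * hit f y.
Proof.
move=> [_ fM]; rewrite !hitE swM; sl.
rewrite (sw_map hopf (g := fun z => z * sw (fun a b => (f b : K) *: a) y)); last by slin.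
apply: eq_sw => a b.
rewrite (sw_map hopf (g := fun z => (f b : K) *: a * z)); last by slin.
by apply: eq_sw => c d; rewrite fM -scalerAl -scalerAr scalerA.
Qed.

Lemma hitbyM f x y : is_character f -> hitby f (x * y) = hitby f x * hitby f y.
Proof.
move=> [_ fM]; rewrite !hitbyE swM; sl.
rewrite (sw_map hopf (g := fun z => z * sw (fun a b => (f a : K) *: b) y)); last by slin.
apply: eq_sw => a b.
rewrite (sw_map hopf (g := fun z => (f a : K) *: b * z)); last by slin.
by apply: eq_sw => c d; rewrite fM -scalerAl -scalerAr scalerA.
Qed.

Lemma hit_grouplike f x : grouplike hopf x -> hit f x = (f x : K) *: x.
Proof. by move=> gx; rewrite hitE gx; slin. Qed.

Lemma hitby_grouplike f x : grouplike hopf x -> hitby f x = (f x : K) *: x.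
Proof. by move=> gx; rewrite hitbyE gx; slin. Qed.

Lemma counit_hit f x : eps (hit f x) = f x.
Proof.
rewrite hitE (sw_map hopf (g := fun z => eps z)); last by slin.
rewrite -[RHS](sw_counitl hopf (F := fun z => f z)); last by slin.
by apply: eq_sw => a b; rewrite linearZ; apply: mulrC.
Qed.

Lemma hit_counit : hit eps = 1.
Proof.
apply/lfunP=> x; rewrite id_lfunE hitE.
by rewrite (sw_counitr hopf (F := fun z => z)); sl.
Qed.

Lemma hitby_counit : hitby eps = 1.
Proof.
apply/lfunP=> x; rewrite id_lfunE hitbyE.
by rewrite (sw_counitl hopf (F := fun z => z)); sl.
Qed.

Lemma counit_character : is_character eps.
Proof. by split; [apply: counit1 | apply: counitM]. Qed.

Lemma conv_lin f g : lin (fun x => sw (fun a b => (f a : K) *: g b) x).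
Proof. by slin. Qed.

Definition conv f g : 'Hom(H, K^o) := mkhom (@conv_lin f g).

Lemma hit_conv f g : hit g * hit f = hit (conv f g).
Proof.
apply/lfunP=> x; rewrite lfun_mulE [hit g x]hitE.
rewrite (sw_map hopf (g := fun z => hit f z)); last by slin.
transitivity (sw (fun w c => sw (fun a b => (f b : K) *: ((g c : K) *: a)) w) x).
  apply: eq_sw => w c; rewrite linearZ /= hitE.
  rewrite (sw_map hopf (g := fun z => (g c : K) *: z)); last by slin.
  by apply: eq_sw => a b; rewrite !scalerA mulrC.
rewrite (sw_assoc hopf (F := fun a b c => (f b : K) *: ((g c : K) *: a))); sl.
rewrite hitE; apply: eq_sw => a v; rewrite mkhomE.
rewrite (sw_map hopf (g := fun z : K^o => (z : K) *: a)); last first.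
  by apply: lin_scalel; apply: lin_id.
by apply: eq_sw => b c; rewrite scalerA.
Qed.

Lemma hitby_conv f g : hitby f * hitby g = hitby (conv f g).
Proof.
apply/lfunP=> x; rewrite lfun_mulE [hitby f x]hitbyE.
rewrite (sw_map hopf (g := fun z => hitby g z)); last by slin.
transitivity (sw (fun a v => sw (fun b c => (f a : K) *: ((g b : K) *: c)) v) x).
  apply: eq_sw => a v; rewrite linearZ /= hitbyE.
  by rewrite (sw_map hopf (g := fun z => (f a : K) *: z)); last by slin.
rewrite -(sw_assoc hopf (F := fun a b c => (f a : K) *: ((g b : K) *: c))); sl.
rewrite hitbyE; apply: eq_sw => v c; rewrite mkhomE.
rewrite (sw_map hopf (g := fun z : K^o => (z : K) *: c)); last first.
  by apply: lin_scalel; apply: lin_id.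
by apply: eq_sw => a b; rewrite scalerA.
Qed.

Lemma conv_character f g : is_character f -> is_character g -> is_character (conv f g).
Proof.
move=> [f1 fM] [g1 gM]; split=> [|x y].
  by rewrite mkhomE sw1 ?f1 ?g1; sl; apply: scale1r.
rewrite !mkhomE swM; sl.
set B := sw _ y; rewrite -[RHS]/((sw (fun a b => (f a : K) *: g b) x : K) *: (B : K^o)).
rewrite (sw_map hopf (g := fun z : K^o => (z : K) *: (B : K^o))); last first.
  by apply: lin_scalel; apply: lin_id.
apply: eq_sw => a b.
rewrite (sw_map hopf (g := fun z : K^o => ((f a : K) *: g b : K) *: z)).
  by apply: eq_sw => c d; rewrite fM gM; apply: mulrACA.
by apply: lin_scaler; apply: lin_id.
Qed.

Lemma hit_exp f i : is_character f ->
  exists g, [/\ is_character g, hit f ^+ i = hit g & hitby f ^+ i = hitby g].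
Proof.
move=> cf; elim: i => [|i [g [cg hit_i hitby_i]]].
  by exists eps; rewrite hit_counit hitby_counit; split=> //; apply: counit_character.
exists (conv g f); split; first exact: conv_character.
  by rewrite exprS hit_i hit_conv.
by rewrite exprSr hitby_i hitby_conv.
Qed.

Lemma characterS f : is_character f -> is_character (f \o S)%VF.
Proof.
move=> [f1 fM]; split=> [|x y]; rewrite !comp_lfunE ?antipode1 //.
by rewrite antipodeM fM mulrC.
Qed.

Lemma hit_antipode f : hitby (f \o S)%VF * S = S * hit f.
Proof.
apply/lfunP=> x; rewrite !lfun_mulE hitE swS; sl; rewrite hitbyE.
rewrite (sw_map hopf (g := fun z => S z)); last by slin.
by apply: eq_sw => a b; rewrite linearZ comp_lfunE.
Qed.

(** The functional [f \o S] is the convolution inverse of [f] on one side and of [f \o S \o S] on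
    the other. [Y] is the triple convolution, contracted in both ways. *)
Lemma characterSS f x : is_character f -> f (S (S x)) = f x.
Proof.
move=> [f1 fM].
pose Y := sw (fun a u => sw (fun b c => f (S (S a)) * (f (S b) *: f c) : K^o) u) x.
transitivity Y.
  rewrite /Y.
  transitivity (sw (fun a u => sw (fun b c => f (S (S a)) *: f (S b * c)) u) x).
    rewrite (sw_Sl_tail hopf (F := fun a z => f (S (S a)) *: f z)); sl.
    by rewrite f1; apply/esym/mulr1.
  by apply: eq_sw => a u; apply: eq_sw => b c; rewrite fM.
transitivity (sw (fun a u => sw (fun b c => f (S (S a * b)) *: f c) u) x).
  apply: eq_sw => a u; apply: eq_sw => b c; rewrite antipodeM fM.
  by rewrite [in RHS]mulrC; apply: mulrA.
rewrite (sw_Sl_head hopf (F := fun z c => f (S z) *: f c)); sl.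
by rewrite antipode1 f1; apply: mul1r.
Qed.

Lemma hit_antipode_sqr f : is_character f -> hit f * T = T * hit f.
Proof.
move=> cf; apply/lfunP=> x; rewrite !lfun_mulE !hitE swSS; sl.
rewrite (sw_map hopf (g := fun z => S (S z))); last by slin.
by apply: eq_sw => a b; rewrite !linearZ characterSS.
Qed.

Lemma hitby_antipode_sqr f : is_character f -> hitby f * T = T * hitby f.
Proof.
move=> cf; apply/lfunP=> x; rewrite !lfun_mulE !hitbyE swSS; sl.
rewrite (sw_map hopf (g := fun z => S (S z))); last by slin.
by apply: eq_sw => a b; rewrite !linearZ characterSS.
Qed.

Lemma hit_hitby f g : hit f * hitby g = hitby g * hit f.
Proof.
apply/lfunP=> x; rewrite !lfun_mulE [hit f x]hitE [hitby g x]hitbyE.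
rewrite (sw_map hopf (g := fun z => hitby g z)); last by slin.
rewrite (sw_map hopf (g := fun z => hit f z)); last by slin.
transitivity (sw (fun a v => sw (fun b c => (g a : K) *: ((f c : K) *: b)) v) x).
  rewrite -(sw_assoc hopf (F := fun a b c => (g a : K) *: ((f c : K) *: b))); sl.
  apply: eq_sw => w c; rewrite linearZ /= hitbyE.
  rewrite (sw_map hopf (g := fun z => (f c : K) *: z)); last by slin.
  by apply: eq_sw => a b; rewrite !scalerA mulrC.
apply: eq_sw => a v; rewrite linearZ /= hitE.
by rewrite (sw_map hopf (g := fun z => (g a : K) *: z)); last by slin.
Qed.

Lemma antipode_grouplike (g : H) : grouplike hopf g -> eps g = 1 ->
  [/\ S g * g = 1, g * S g = 1 & S (S g) = g].
Proof.
move=> grp eg.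
have Sl : S g * g = 1.
  have := antipodeL hopf g; rewrite -[tens_lift _ _]/(sw (fun a b => S a * b) g).
  by rewrite grp ?eg ?scale1r //; slin.
have Sr : g * S g = 1.
  have := antipodeR hopf g; rewrite -[tens_lift _ _]/(sw (fun a b => a * S b) g).
  by rewrite grp ?eg ?scale1r //; slin.
split=> //; rewrite -[LHS]mul1r -Sr -mulrA.
by have := congr1 S Sl; rewrite antipodeM antipode1 => ->; rewrite mulr1.
Qed.

End Characters.

(** * Orders and vanishing traces *)

Section Orders.
Variables (k : closedFieldType) (H : falgType k) (hopf : hopf_algebra H).
Hypothesis char0 : [pchar k] =i pred0.
Hypothesis dim_gt0 : (0 < \dim {:H})%N.
Hypothesis S_onto : forall y, exists x, antipode hopf x = y.
Hypothesis nss : ~ semisimple_alg H.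
Implicit Types (f : 'Hom(H, k^o)) (g x y h : H).
Local Notation eps := (counit hopf).
Local Notation S := (antipode hopf).
Local Notation sw := (sweedler hopf).
Local Notation hit := (hit hopf).
Local Notation hitby := (hitby hopf).
Local Notation T := (S * S).
Local Notation n := (\dim {:H}).
Local Notation tr := lfun_trace.

Let Phi : {linear 'M[k]_n -> 'M[k]_n} := mklin (left_shift_lin hopf).

Lemma mx_unit (F G : 'End(H)) : G * F = 1 -> mx F \in unitmx.
Proof. by move/(congr1 (@mx _ _)); rewrite mxM mx1 => /mulmx1_unit[]. Qed.

(** The coproduct of [g * hit f x] is [g * x_(1) (x) g * hit f x_(2)]: the group-like element
    multiplies both legs, while [hit f] touches only the last one. *)
Lemma left_shift_intertwine f g (X : 'M[k]_n) : grouplike hopf g ->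
  Phi ((mx (hit f * amull g))^T *m X) = (mx (hit f * amull g))^T *m Phi X *m mx (amull g).
Proof.
move=> grp; set F := hit f * amull g.
apply: (eq_tens_lin (F := fun t => Phi ((mx F)^T *m (t : 'M_n)))
   (G := fun t => (mx F)^T *m Phi t *m mx (amull g))) => [a s t|a s t|x y].
- by rewrite mulmxDr -scalemxAr linearP.
- by rewrite linearP mulmxDr mulmxDl -scalemxAr -scalemxAl.
rewrite mx_tens_purel /= !left_shiftE.
rewrite (sw_map hopf (g := fun z : 'M[k]_n => (mx F)^T *m z *m mx (amull g))); last first.
  by move=> a s t; rewrite mulmxDr mulmxDl -scalemxAr -scalemxAl.
under [RHS]eq_sw => a b do rewrite mx_tens_pure amullE.
pose Y := sw (fun a v => sw (fun b c => (f c : k) *: ((g * b) \ot (g * (a * y)))) v) x.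
transitivity Y; last first.
  apply: eq_sw => a v; rewrite lfun_mulE amullE hitE.
  rewrite (sw_map hopf (g := fun z => (g * z) \ot (g * (a * y)))); last by slin.
  by apply: eq_sw => b c; rewrite -scalerAr (linZ _ _ (lin_otl _ (@lin_id _ H))).
rewrite /Y -(sw_assoc hopf (F := fun a b c =>
  (f c : k) *: ((g * b) \ot (g * (a * y))))); sl.
rewrite lfun_mulE amullE swM; sl; rewrite grp; sl.
rewrite hitE (sw_map hopf (g := fun z => sw (fun c d => (g * d) \ot (g * c * y)) z));
  last by slin.
apply: eq_sw => w c; rewrite (linZ _ _ (lin_sw hopf _ (@lin_id k H))).
rewrite (sw_map hopf (g := fun z => (f c : k) *: z)); last by slin.
by apply: eq_sw => a b; rewrite mulrA.
Qed.

Lemma left_shift_trace f g : grouplike hopf g ->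
  n%:R * tr (hit f * amull g) = tr (hit f * amull g) * tr (amull g).
Proof.
move=> grp.
have := mxtrace_mul_intertwine (@left_shift_inj _ _ _ S_onto)
  (fun X => @left_shift_intertwine f g X grp).
by rewrite mxtrace_tr.
Qed.

Lemma amull_mul (u v : H) : amull (u * v) = amull v * amull u.
Proof. by apply/lfunP=> x; rewrite lfun_mulE !amullE mulrA. Qed.

Lemma amull_1 : amull (1 : H) = 1.
Proof. by apply/lfunP=> x; rewrite amullE mul1r id_lfunE. Qed.

Lemma grouplike_order g : grouplike hopf g -> eps g = 1 ->
  exists N, [/\ (0 < N)%N, (N %| n)%N, amull g ^+ N = 1 &
                forall i, ~~ (N %| i)%N -> tr (amull g ^+ i) = 0].
Proof.
move=> grp eps_g; have [Sl Sr _] := antipode_grouplike grp eps_g.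
have unit_g : mx (amull g) \in unitmx.
  by apply: (@mx_unit _ (amull (S g))); rewrite -amull_mul Sr amull_1.
have [|N [N0 Nn gN trg]] := grouplike_operator_trace char0 dim_gt0 unit_g
   (@left_shift_inj _ _ _ S_onto).
  move=> X; have := left_shift_intertwine eps X grp.
  by rewrite hit_counit mul1r.
exists N; split=> // [|i Ni]; first by apply: (@mx_inj _ H); rewrite mxX gN mx1.
by rewrite -[LHS]/(\tr (mx _)) mxX trg.
Qed.

(** The transpose exchanges the tensor factors, so that an operator on the second factor becomes a
    left multiplication, as [mxtrace_mul_intertwine] requires. *)
Lemma right_unshift_tr_lin :
  lin (fun X : 'M[k]_n => right_unshift hopf (X^T : tensv H H) : 'M[k]_n).
Proof.
by apply: (lin_comp (right_unshift_lin hopf)) => a X Y; rewrite !linearP.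
Qed.

Let Psi : {linear 'M[k]_n -> 'M[k]_n} := mklin right_unshift_tr_lin.

Lemma right_unshift_tr_inj : injective Psi.
Proof.
by move=> X Y /(can_inj (right_unshiftK S_onto)) /(can_inj (@trmxK _ _ _)).
Qed.

(** Since [f] is a character, [hit f] is multiplicative: its action on [u], pushed through the
    coproduct, joins the one on [y * v] into [hit f (y * v * u_(2))]. *)
Lemma right_shift_intertwine f y (X : 'M[k]_n) : is_character f ->
  right_shift hopf ((mx (hit f))^T *m X *m mx (amull y * hit f)) =
  (right_shift hopf X : 'M[k]_n) *m mx (amull y * hit f).
Proof.
move=> cf; set F := amull y * hit f.
apply: (eq_tens_lin
   (F := fun t => right_shift hopf ((mx (hit f))^T *m (t : 'M_n) *m mx F))
   (G := fun t => (right_shift hopf t : 'M_n) *m mx F)) => [||u v].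
- apply: (lin_comp (right_shift_lin hopf)) => a s t.
  by rewrite mulmxDr mulmxDl -scalemxAr -scalemxAl.
- by move=> a s t; rewrite right_shift_lin mulmxDl -scalemxAl.
rewrite mx_tens_pure !right_shiftE.
rewrite (sw_map hopf (g := fun z : 'M[k]_n => z *m mx F)); last first.
  by move=> a s t; rewrite mulmxDl -scalemxAl.
under [RHS]eq_sw => a b do rewrite mx_tens_purer lfun_mulE amullE mulrA hitM //.
rewrite [hit f u]hitE lfun_mulE amullE.
rewrite (sw_map hopf (g := fun z => sw (fun a b => a \ot (hit f (y * v) * b)) z));
  last by slin.
transitivity (sw (fun a w => sw (fun b c =>
    (f c : k) *: (a \ot (hit f (y * v) * b))) w) u).
  rewrite -(sw_assoc hopf (F := fun a b c =>
    (f c : k) *: (a \ot (hit f (y * v) * b)))); sl.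
  apply: eq_sw => w c; rewrite (linZ _ _ (lin_sw hopf _ (@lin_id k H))).
  by rewrite (sw_map hopf (g := fun z => (f c : k) *: z)); last by slin.
apply: eq_sw => a w; rewrite [hit f w]hitE.
rewrite (sw_map hopf (g := fun z => a \ot (hit f (y * v) * z))); last by slin.
apply: eq_sw => b c; rewrite -scalerAr.
by rewrite (linZ _ _ (lin_otr _ (@lin_id _ H))).
Qed.

Lemma right_unshift_intertwine f y X : is_character f ->
  Psi ((mx (amull y * hit f))^T *m X) =
  (mx (hit f))^T *m Psi X *m mx (amull y * hit f).
Proof.
move=> cf; apply: (can_inj (right_shiftK S_onto)); rewrite right_shift_intertwine //=.
by rewrite !(right_unshiftK S_onto) trmx_mul trmxK.
Qed.

Lemma right_shift_trace f y : is_character f ->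
  n%:R * tr (amull y * hit f) = tr (hit f) * tr (amull y * hit f).
Proof.
move=> cf.
have := mxtrace_mul_intertwine right_unshift_tr_inj
  (fun X => @right_unshift_intertwine f y X cf).
by rewrite !mxtrace_tr.
Qed.

Lemma hit_unit f : is_character f -> mx (hit f) \in unitmx.
Proof.
move=> cf; apply: (@mx_unit _ (hit (f \o S)%VF)).
have [f1 fM] := cf; rewrite hit_conv -(hit_counit hopf); congr hit.
apply/lfunP=> x; rewrite mkhomE.
transitivity (sw (fun a b => f (a * S b)) x).
  by apply: eq_sw => a b; rewrite comp_lfunE fM.
by rewrite (sw_Sr hopf (F := fun z => f z)) ?f1; [apply: mulr1 | slin].
Qed.

Lemma hit_order f : is_character f ->
  exists N, [/\ (0 < N)%N, (N %| n)%N, hit f ^+ N = 1 &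
                forall i, ~~ (N %| i)%N -> tr (hit f ^+ i) = 0].
Proof.
move=> cf.
have [|N [N0 Nn fN trf]] := grouplike_operator_trace char0 dim_gt0 (hit_unit cf)
   right_unshift_tr_inj.
  by move=> X; have := right_unshift_intertwine 1 X cf; rewrite amull_1 mul1r.
exists N; split=> // [|i Ni]; first by apply: (@mx_inj _ H); rewrite mxX fN mx1.
by rewrite -[LHS]/(\tr (mx _)) mxX trf.
Qed.

Lemma trace_hitby_vanish x f : is_character f -> tr (hitby f * T * amulr x) = 0.
Proof. by move=> cf; rewrite -mulrA; apply: trace_vanish. Qed.

(** Conjugation by [S] turns left multiplication by [S x] into right multiplication by [x], and
    [hit f] into [hitby (f \o S)]. *)
Lemma trace_hit_vanish y f : is_character f -> tr (hit f * T * amull y) = 0.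
Proof.
move=> cf; have [x <-] := S_onto y.
rewrite -(trace_hitby_vanish x (characterS hopf cf)).
have SK : S * (S^-1)%VF = 1 by apply/lfunP=> z; rewrite lfun_mulE id_lfunE antipodeK.
have KS : (S^-1)%VF * S = 1 by apply/lfunP=> z; rewrite lfun_mulE id_lfunE antipodeVK.
have SR : S * amull (S x) = amulr x * S.
  by apply/lfunP=> z; rewrite !lfun_mulE amullE amulrE antipodeM.
have -> : hitby (f \o S)%VF * T * amulr x =
    S * (hit f * T * amull (S x)) * (S^-1)%VF.
  by rewrite !mulrA hit_antipode -!mulrA [S * (amull _ * _)]mulrA SR -mulrA SK mulr1.
have trC (u v : 'End(H)) : tr (u * v) = tr (v * u) := lfun_traceC v u.
by rewrite [RHS]trC !mulrA KS mul1r.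
Qed.

(** Characters act by algebra maps, so multiplications can be moved past them; each power of [P] or
    [Q] is again the action of a character followed by one multiplication. *)
Lemma trace_exp_vanish (P Q : 'End(H)) g f i : is_character f ->
    P = hit f * amull g -> Q = hitby f * amulr g ->
  tr (T * P ^+ i) = 0 /\ tr (T * Q ^+ i) = 0.
Proof.
move=> cf -> ->.
have swapL (C : 'End(H)) y : (forall u v, C (u * v) = C u * C v) ->
    amull y * C = C * amull (C y).
  by move=> CM; apply/lfunP=> z; rewrite !lfun_mulE !amullE CM.
have swapR (C : 'End(H)) y : (forall u v, C (u * v) = C u * C v) ->
    amulr y * C = C * amulr (C y).
  by move=> CM; apply/lfunP=> z; rewrite !lfun_mulE !amulrE CM.
have expL : exists y, (hit f * amull g) ^+ i = hit f ^+ i * amull y.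
  elim: i => [|i [y IHi]]; first by exists 1; rewrite amull_1 mulr1.
  have [c [cc ci _]] := hit_exp hopf i cf.
  exists (y * hit c g); rewrite exprS IHi ci exprS ci amull_mul -!mulrA.
  by congr (_ * _); rewrite !mulrA swapL // => u v; apply: hitM.
have expR : exists y, (hitby f * amulr g) ^+ i = hitby f ^+ i * amulr y.
  elim: i {expL} => [|i [y IHi]]; first by exists 1; rewrite rmorph1 mulr1.
  have [c [cc _ ci]] := hit_exp hopf i cf.
  exists (hitby c g * y); rewrite exprS IHi ci exprS ci rmorphM -!mulrA.
  by congr (_ * _); rewrite !mulrA swapR // => u v; apply: hitbyM.
have [c [cc ci ci']] := hit_exp hopf i cf.
have [y ->] := expL; have [z ->] := expR.
rewrite ci ci' !mulrA; split.
  by rewrite -hit_antipode_sqr // trace_hit_vanish.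
by rewrite -hitby_antipode_sqr // trace_hitby_vanish.
Qed.

Lemma grouplike_antipode_sqr g : grouplike hopf g -> eps g = 1 ->
  T * amull g = amull g * T.
Proof.
move=> grp eps_g; have [_ _ SSg] := antipode_grouplike grp eps_g.
by apply/lfunP=> z; rewrite !lfun_mulE !amullE !antipodeM SSg.
Qed.

Lemma grouplikeX g i : grouplike hopf g -> grouplike hopf (g ^+ i).
Proof.
move=> grp; elim: i => [|i IHi] W F F1 F2; first by rewrite expr0 sw1.
have lF2 (U : vectType k) (h : U -> H) c : lin h -> lin (fun z => F c (h z)).
  by move=> lf; apply: lin_comp.
have lF1 (U : vectType k) (h : U -> H) c : lin h -> lin (fun z => F (h z) c).
  by move=> lf; apply: (lin_comp (g := F^~ c)).
by rewrite exprS swM // grp ?IHi //; slin.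
Qed.

Lemma amullX g i : amull g ^+ i = amull (g ^+ i).
Proof.
elim: i => [|i IHi]; first by rewrite !expr0 amull_1.
by rewrite exprSr IHi -amull_mul -exprS.
Qed.

(** The condition [f g = 1] makes [hit f] and [amull g] commute, and their product [U] meets the
    hypotheses of [regular_operator_absurd]. *)
Lemma regular_pair_absurd g f N M : grouplike hopf g -> eps g = 1 ->
    is_character f -> f g = 1 ->
    amull g ^+ N = 1 -> (forall i, ~~ (N %| i)%N -> tr (amull g ^+ i) = 0) ->
    hit f ^+ M = 1 -> (forall i, ~~ (M %| i)%N -> tr (hit f ^+ i) = 0) ->
    coprime N M -> (N * M)%N = n -> False.
Proof.
move=> grp eps_g cf fg gN trg fM trf coNM NMn.
pose U := hit f * amull g.
have comU : hit f * amull g = amull g * hit f.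
  apply/lfunP=> x; rewrite !lfun_mulE !amullE hitM // (hit_grouplike _ grp).
  by rewrite fg scale1r.
have UX i : U ^+ i = hit f ^+ i * amull g ^+ i by apply: exprMn_comm.
have n_neq0 : n%:R != 0 :> k by apply: natr_neq0.
apply: (@regular_operator_absurd k char0 n (mx T) (mx U)) => //.
- have SK : (S^-1)%VF * S = 1.
    by apply/lfunP=> z; rewrite lfun_mulE id_lfunE antipodeVK.
  apply: (@mx_unit _ ((S^-1)%VF * (S^-1)%VF)).
  by rewrite !mulrA -(mulrA (S^-1)%VF) SK mulr1 SK.
- rewrite /U -!mxM mulrA -hit_antipode_sqr // -!mulrA; congr (mx (_ * _)).
  by rewrite mulrA grouplike_antipode_sqr // mulrA.
- suff Un : U ^+ n = 1 by rewrite -mxX Un mx1.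
  rewrite UX -NMn [X in _ * X]exprM gN expr1n mulr1 mulnC exprM fM.
  exact: expr1n.
- move=> i /andP[i0 lt_in]; rewrite -mxX -[LHS]/(tr _) UX.
  apply: (mulfI n_neq0); rewrite mulr0.
  (* If [N] does not divide [i], the trace vanishes through the group-like factor. Otherwise [M]
     does not divide [i], by coprimality and [i < N * M], and it vanishes through the character. *)
  have [Ni|Ni] := boolP (N %| i)%N; last first.
    have [c [cc -> _]] := hit_exp hopf i cf.
    rewrite amullX left_shift_trace; last exact: grouplikeX.
    by rewrite -amullX trg ?mulr0.
  have Mi : ~~ (M %| i)%N.
    apply/negP => Mi; have : (N * M %| i)%N by rewrite Gauss_dvd // Ni.
    by rewrite NMn => /(dvdn_leq i0); rewrite leqNgt lt_in.
  have -> : hit f ^+ i * amull g ^+ i = amull g ^+ i * hit f ^+ i.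
    by rewrite -UX [in RHS](commrX i (commr_sym (commrX i comU))).
  have [c [cc ci _]] := hit_exp hopf i cf.
  by rewrite ci amullX right_shift_trace // -ci trf ?mul0r.
- move=> i; rewrite -mxX -mxM.
  have [trT _] := trace_exp_vanish i cf (erefl U) (erefl (hitby f * amulr g)).
  exact: trT.
Qed.

End Orders.

(** * Dimension pq *)

(** Each exchange of a [y] with a later [x] costs a factor [c], and ['C(i, 2)] exchanges are
    needed. *)
Lemma exprM_skew (F : fieldType) (A : algType F) (c : F) (x y : A) i :
    y * x = c *: (x * y) ->
  (x * y) ^+ i = c ^+ 'C(i, 2) *: (x ^+ i * y ^+ i).
Proof.
move=> yx.
have yix j : y ^+ j * x = c ^+ j *: (x * y ^+ j).
  elim: j => [|j IHj]; first by rewrite mul1r mulr1 scale1r.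
  rewrite [in LHS]exprSr -mulrA yx -scalerAr mulrA IHj.
  by rewrite -scalerAl scalerA -exprS -mulrA -exprSr.
elim: i => [|i IHi]; first by rewrite scale1r mulr1.
rewrite exprSr IHi -scalerAl binS bin1 exprD -scalerA; congr (_ *: _).
by rewrite -mulrA [y ^+ i * _]mulrA yix -scalerAl -scalerAr -!mulrA -exprSr mulrA -exprSr.
Qed.

Lemma det_exp (R : comNzRingType) n (A : 'M[R]_n) i : \det (A ^+ i) = \det A ^+ i.
Proof. by elim: i => [|i IHi]; rewrite ?det1 // !exprS det_mulmx IHi. Qed.

(** Orders [p] and [q] with [p = q] fall under the first alternative, so the last one only has to
    cover coprime orders. *)
Lemma dvdn_prime_mul_cases p q N M : prime p -> prime q ->
    (N %| p * q)%N -> (M %| p * q)%N ->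
    [\/ exists2 r, (r = p) \/ (r = q) & (N %| r)%N && (M %| r)%N,
        N = (p * q)%N, M = (p * q)%N |
        coprime N M /\ (N * M)%N = (p * q)%N].
Proof.
move=> pp pq.
have div K : (K %| p * q)%N -> [\/ K = 1%N, K = p, K = q | K = (p * q)%N].
  move=> dK; have [pK|pK] := boolP (p %| K)%N.
    have /dvdnP[j Ej] := pK.
    rewrite Ej [X in (_ %| X)%N]mulnC dvdn_pmul2r ?prime_gt0 // in dK.
    have /primeP[_ /(_ _ dK)/orP[/eqP j1|/eqP jq]] := pq.
      by rewrite Ej j1 mul1n; constructor 2.
    by rewrite Ej jq mulnC; constructor 4.
  have : (K %| q)%N by rewrite -(Gauss_dvdr _ (n := p)) // coprime_sym prime_coprime.
  by case/primeP: pq => _ h /h /orP[/eqP->|/eqP->]; [constructor 1 | constructor 3].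
move=> /div dN /div dM.
case: dN => ->; case: dM => ->;
  try by [constructor 2 | constructor 3];
  try by [constructor 1; exists p; [left | rewrite ?dvd1n ?dvdnn]
        | constructor 1; exists q; [right | rewrite ?dvd1n ?dvdnn]].
- have [->|neq] := eqVneq p q; first by constructor 1; exists q; [left | rewrite dvdnn].
  by constructor 4; rewrite prime_coprime // dvdn_prime2.
- have [->|neq] := eqVneq p q; first by constructor 1; exists q; [left | rewrite dvdnn].
  by constructor 4; rewrite prime_coprime // dvdn_prime2 // eq_sym mulnC.
Qed.

Section Main.
Variables (k : closedFieldType) (H : falgType k) (hopf : hopf_algebra H).
Hypothesis char0 : [pchar k] =i pred0.
Hypothesis dim_gt0 : (0 < \dim {:H})%N.
Hypothesis S_onto : forall y, exists x, antipode hopf x = y.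
Hypothesis nss : ~ semisimple_alg H.
Local Notation eps := (counit hopf).
Local Notation S := (antipode hopf).
Local Notation hit := (hit hopf).
Local Notation hitby := (hitby hopf).
Local Notation T := (S * S).
Local Notation n := (\dim {:H}).
Local Notation tr := lfun_trace.
Local Notation e := (vbasis {:H}).

Lemma hit_exp1_grouplike (g : H) (f : 'Hom(H, k^o)) r :
  grouplike hopf g -> eps g = 1 -> hit f ^+ r = 1 -> f g ^+ r = 1.
Proof.
move=> grp eps_g fr.
have hitX i : (hit f ^+ i) g = (f g ^+ i : k) *: g.
  elim: i => [|i IHi]; first by rewrite id_lfunE scale1r.
  by rewrite exprSr lfun_mulE IHi linearZ /= hit_grouplike // scalerA -exprSr.
have := congr1 eps (hitX r); rewrite fr id_lfunE linearZ /= eps_g => h.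
by rewrite [RHS]h; apply/esym/mulr1.
Qed.

Lemma trace_antipode_prime (g : H) (f : 'Hom(H, k^o)) r :
    prime r -> odd r -> grouplike hopf g -> eps g = 1 -> is_character f ->
    (forall x, hitby f x = g * T (T (hit f x)) * S g) ->
    \det (passmx.mxof e e (T \o hit f)%VF) = 1 ->
    amull g ^+ r = 1 -> hit f ^+ r = 1 ->
  exists d m, [/\ tr (T ^+ r) = (r ^ 2)%:R * d%:~R, (4 * m <= 2 * n)%N &
                  tr (T ^+ r) = n%:R - (4 * m)%:R].
Proof.
move=> pr_r odd_r grp eps_g cf radford detT gr fr.
have [Sl Sr SSg] := antipode_grouplike grp eps_g.
pose P := hit f * amull g; pose Q := hitby f * amulr g.
have fgr := hit_exp1_grouplike grp eps_g fr.
(* An odd prime [r] divides ['C(r, 2)], so the scalar produced by [exprM_skew] disappears from the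
   [r]-th powers of [P] and [Q]. *)
have fgC : f g ^+ 'C(r, 2) = 1.
  have /dvdnP[j ->] : (r %| 'C(r, 2))%N.
    by apply: prime_dvd_bin => //; case: r pr_r odd_r {gr fr fgr} => [|[|[|r]]].
  by rewrite mulnC exprM fgr expr1n.
have gr' : amulr g ^+ r = 1.
  rewrite -rmorphXn; have := congr1 (fun F : 'End(H) => F 1) gr.
  by rewrite amullX amullE mulr1 id_lfunE => ->; rewrite rmorph1.
have fr' : hitby f ^+ r = 1.
  have [c [_ cr cr']] := hit_exp hopf r cf.
  rewrite cr' -(hitby_counit hopf); congr hitby; apply/lfunP=> x.
  by rewrite -(counit_hit hopf c x) -cr fr id_lfunE.
have Pr : P ^+ r = 1.
  rewrite (exprM_skew (c := f g)) ?fgC ?scale1r ?fr ?gr ?mulr1 //.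
  apply/lfunP=> x; rewrite scale_lfunE !lfun_mulE !amullE hitM //.
  by rewrite (hit_grouplike _ grp) -scalerAl.
have Qr : Q ^+ r = 1.
  rewrite (exprM_skew (c := f g)) ?fgC ?scale1r ?fr' ?gr' ?mulr1 //.
  apply/lfunP=> x; rewrite scale_lfunE !lfun_mulE !amulrE hitbyM //.
  by rewrite (hitby_grouplike _ grp) -scalerAr.
have TP : T * P = P * T.
  rewrite /P mulrA -hit_antipode_sqr // -!mulrA; congr (_ * _).
  by rewrite mulrA grouplike_antipode_sqr // mulrA.
have TQ : T * Q = Q * T.
  rewrite /Q mulrA -hitby_antipode_sqr // -!mulrA; congr (_ * _).
  by apply/lfunP=> x; rewrite !lfun_mulE !amulrE !antipodeM SSg.
have PQ : P * Q = Q * P.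
  apply/lfunP=> x; rewrite !lfun_mulE !amullE !amulrE hitM // hitbyM //.
  rewrite (hit_grouplike _ grp) (hitby_grouplike _ grp) -!lfun_mulE hit_hitby.
  by rewrite -!scalerAl -!scalerAr mulrA.
have TTP : T ^+ 2 * P = Q.
  have TTA : T ^+ 2 * hit f = hit f * T * T.
    by rewrite hit_antipode_sqr // -[RHS]mulrA hit_antipode_sqr // mulrA.
  apply/lfunP=> x; rewrite /P /Q mulrA TTA !(lfun_mulE _ _ x) amullE amulrE radford.
  by rewrite -[RHS]mulrA Sl mulr1 !lfun_mulE.
have trPQ i := trace_exp_vanish S_onto nss i cf (erefl P) (erefl Q).
have [||||||i|i|d trT] := @trace_expr_prime_square k char0 n r
  (mx T) (mx P) (mx Q) pr_r odd_r.
- by rewrite -!mxM TP.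
- by rewrite -!mxM TQ.
- by rewrite -!mxM PQ.
- by rewrite -mxX Pr mx1.
- by rewrite -mxX Qr mx1.
- by rewrite -mxX -mxM TTP.
- by rewrite -mxX -mxM; apply: (trPQ i).1.
- by rewrite -mxX -mxM; apply: (trPQ i).2.
have [||m m_n trTm] := @trace_involution_det1 k char0 n (mx T ^+ r).
- have := congr1 (fun F : 'End(H) => F ^+ r) TTP.
  have cTP : GRing.comm (T ^+ 2) P by apply: commr_sym; apply: commrX; apply: commr_sym.
  rewrite Qr (exprMn_comm _ cTP) Pr mulr1 => TTr.
  by rewrite -!mxX -exprM mulnC exprM TTr mx1.
(* As [hit f] has [r]-th power 1, it may be inserted: the determinant of [T ^+ r] is the [r]-th
   power of that of [T] composed with [hit f]. *)
- have detA : \det (mx (hit f)) ^+ r = 1 by rewrite -det_exp -mxX fr mx1 det1.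
  rewrite det_exp -[LHS]mul1r -detA -exprMn -det_mulmx -[_ *m _]mxM.
  by rewrite [\det _]detT expr1n.
by exists d, m; split=> //; rewrite -[LHS]/(\tr (mx _)) mxX.
Qed.

End Main.

Theorem theorem3p3 (k : closedFieldType) (char0 : [pchar k] =i pred0)
    (p q : nat) (p_prime : prime p) (q_prime : prime q)
    (p_odd : odd p) (q_odd : odd q) (le_pq : (p <= q)%N)
    (H : falgType k) (hopfH : hopf_algebra H)
    (dimH : \dim {:H} = (p * q)%N) (nssH : ~ semisimple_alg H) :
  exists d : int,
    lfun_trace (antipode hopfH ^+ (2 * p)) = (p ^ 2)%:R * d%:~R /\
    (d = (p * q)%N%:Z %[mod 4])%Z.
Proof.
have p_gt0 := prime_gt0 p_prime; have q_gt0 := prime_gt0 q_prime.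
have dim_gt0 : (0 < \dim {:H})%N by rewrite dimH muln_gt0 p_gt0.
have [lam lamI lam_neq0] := exists_dual_left_integral hopfH (natr_neq0 char0 dim_gt0).
have S_onto := antipode_surjective lamI lam_neq0.
have [g [f [eps_g grp cf radford detT]]] := radford_formula lamI lam_neq0.
have [N [N0 dvdN gN trg]] := grouplike_order char0 dim_gt0 S_onto grp eps_g.
have [M [M0 dvdM fM trf]] := hit_order char0 dim_gt0 S_onto cf.
have absurd := regular_pair_absurd char0 dim_gt0 S_onto nssH.
have ccf := counit_character hopfH.
have trace r : prime r -> odd r -> (N %| r)%N -> (M %| r)%N ->
    exists d m, [/\ lfun_trace ((antipode hopfH * antipode hopfH) ^+ r) =
        (r ^ 2)%:R * d%:~R,
      ((r ^ 2)%:Z * d = (p * q)%:Z - (4 * m)%:Z)%R & (4 * m <= 2 * (p * q))%N].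
  move=> pr_r odd_r /dvdnP[i ri] /dvdnP[j rj].
  have gr : amull g ^+ r = 1 by rewrite ri mulnC exprM gN expr1n.
  have fr : hit hopfH f ^+ r = 1 by rewrite rj mulnC exprM fM expr1n.
  have [d [m [trd m_le trm]]] := trace_antipode_prime char0 S_onto nssH
    pr_r odd_r grp eps_g cf radford detT gr fr.
  exists d, m; rewrite -dimH; split=> //; apply: (intr_inj_char0 char0).
  by rewrite /= rmorphM rmorphB /= -!pmulrn -trd trm.
rewrite dimH in dvdN dvdM.
have S2 : antipode hopfH ^+ (2 * p) = (antipode hopfH * antipode hopfH) ^+ p.
  by rewrite exprM expr2.
have concl r : r = p -> (N %| r)%N -> (M %| r)%N -> exists d : int,
    lfun_trace (antipode hopfH ^+ (2 * p)) = (p ^ 2)%:R * d%:~R /\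
    (d = (p * q)%N%:Z %[mod 4])%Z.
  move=> -> Np Mp; have [d [m [trd dE _]]] := trace p p_prime p_odd Np Mp.
  exists d; split; first by rewrite S2.
  have p_half : p = (p./2.*2).+1 by rewrite -[LHS]odd_double_half p_odd.
  apply/eqP; rewrite eqz_mod_dvd; apply/dvdzP.
  (* With [p = 2 * h + 1] one has [p ^ 2 = 4 * (h * h + h) + 1], so [p ^ 2 * d = p * q - 4 * m]
     gives [d - p * q] as 4 times this witness. *)
  exists (- (m%:Z) - ((p./2 * p./2 + p./2)%:Z * d)).
  have := dE; rewrite {1}p_half; lia.
have [[r [rp|rq] /andP[Nr Mr]]|Npq|Mpq|[coNM NMpq]] :=
    dvdn_prime_mul_cases p_prime q_prime dvdN dvdM.
- exact: (concl r).
- have [qp|q_neq_p] := eqVneq q p; first by apply: (concl r) => //; rewrite rq.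
  rewrite rq in Nr Mr; have [d [m [_ dE m_le]]] := trace q q_prime q_odd Nr Mr.
  have lt_pq : (p < q)%N by rewrite ltn_neqAle eq_sym q_neq_p.
  have odd_pq : odd (p * q) by rewrite oddM p_odd.
  (* The bound on [m] puts [p * q - 4 * m] between [- (p * q)] and [p * q], while [q ^ 2] exceeds
     [p * q]. *)
  have d0 : d = 0.
    have lt_pqq : (p * q < q ^ 2)%N by rewrite -mulnn ltn_pmul2r.
    move: dE lt_pqq m_le; move: (q ^ 2)%N (p * q)%N => a b; clear.
    nia.
  by move: dE odd_pq; rewrite d0 mulr0; move: (p * q)%N => b; lia.
(* When [N = p * q], the group-like element alone suffices, paired with the trivial character. *)
- case: (absurd g (counit hopfH) N 1%N) => //.
  + by rewrite expr1 hit_counit.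
  + by move=> i; rewrite dvd1n.
  + by rewrite coprimen1.
  + by rewrite muln1 dimH.
(* When [M = p * q], the character alone suffices, paired with the trivial group-like element. *)
- case: (absurd 1 f 1%N M) => //.
  + by move=> W F F1 F2; rewrite sw1.
  + exact: counit1.
  + by case: cf.
  + by rewrite expr1 amull_1.
  + by move=> i; rewrite dvd1n.
  + by rewrite coprime1n.
  + by rewrite mul1n dimH.
- case: (absurd g f N M) => //; last by rewrite dimH.
  (* The value [f g] is both an [N]-th and an [M]-th root of unity, hence 1 by coprimality. *)
  have fgM := hit_exp1_grouplike grp eps_g fM.
  have fgN : f g ^+ N = 1.
    have gX i : f (g ^+ i) = f g ^+ i.
      elim: i => [|i IHi]; first by case: cf.
      by rewrite !exprS (cf.2 g) IHi.
    have := congr1 (fun F : 'End(H) => f (F 1)) gN.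
    by rewrite amullX amullE mulr1 id_lfunE gX cf.1.
  have [a prim_a a_M] := prim_order_exists M0 fgM.
  have a_N : (a %| N)%N by rewrite (prim_order_dvd prim_a) fgN.
  have : (a %| gcdn N M)%N by rewrite dvdn_gcd a_N.
  rewrite (eqP coNM) dvdn1 => /eqP a1.
  by have := prim_expr_order prim_a; rewrite a1 expr1.
Qed.
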